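(* Fix $z_0$ in the upper half-plane $H$. For $\gamma_1,\gamma_2\in\mathrm{SL}(2,\mathbb{R})$ set $$\tau(\gamma_1,\gamma_2)=\int_{z_0}^{\gamma_2\cdot z_0}\mu_{\gamma_1}(z)\,dz=\frac1{12\pi i}\left(\log\psi_{\gamma_1}(\gamma_2\cdot z_0)-\log\psi_{\gamma_1}(z_0)\right),\qquad \psi_\gamma=\frac{\Delta|\gamma}{\Delta},$$ where $\mu_\gamma=\frac{1}{12\pi i}\frac{d}{dz}\log\frac{\Delta|\gamma}{\Delta}$. Then the $2$-cocycle $\operatorname{Re}\tau\in Z^2(\mathrm{SL}(2,\mathbb{R})^{\delta},\mathbb{R})$ represents the Euler class $e\in H^2(\mathrm{SL}(2,\mathbb{R})^{\delta},\mathbb{R})$.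
   Context: $\mathrm{SL}(2,\mathbb{R})^{\delta}$ is $\mathrm{SL}(2,\mathbb{R})$ as a discrete group; group cohomology is computed with inhomogeneous cochains and trivial coefficients, so that $(\partial f)(\gamma_1,\gamma_2)=f(\gamma_2)-f(\gamma_1\gamma_2)+f(\gamma_1)$. The group $\mathrm{GL}^+(2,\mathbb{R})$ acts on $H$ by fractional linear transformations. $\Delta(z)=(2\pi)^{12}q\prod_{n\ge1}(1-q^n)^{24}$, $q=e^{2\pi iz}$, is the discriminant cusp form of weight $12$, and for $\gamma=\begin{pmatrix}a&b\\c&d\end{pmatrix}\in\mathrm{GL}^+(2,\mathbb{R})$, $\Delta|\gamma(z)=\det(\gamma)^{6}\,\Delta\left(\frac{az+b}{cz+d}\right)(cz+d)^{-12}$. Since $\psi_\gamma$ has no zero on $H$, a continuous branch of $\log\psi_\gamma$ on $H$ exists, and its choice is immaterial in the definition of $\tau$. The Euler class $e$ is the image in $H^2(\mathrm{SL}(2,\mathbb{R})^\delta,\mathbb{R})$ of the integral Euler class of flat oriented circle bundles associated with the action of $\mathrm{SL}(2,\mathbb{R})$, through $\mathrm{PSL}(2,\mathbb{R})$, on $\mathbb{P}^1(\mathbb{R})$; equivalently the class of the central extension of $\mathrm{PSL}(2,\mathbb{R})$ by $\mathbb{Z}$ given by its universal cover, pulled back to $\mathrm{SL}(2,\mathbb{R})$. The sign is normalized so that for a lift to $\mathrm{SL}(2,\mathbb{R})$ of the uniformizing representation of the fundamental group of a closed oriented hyperbolic surface $\Gamma\backslash H$ of genus $g\ge2$ (with the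 orientation of $H$), $e$ evaluates on the fundamental class to the Euler characteristic $2-2g$. *)

(* Defs.v *)
(* Stdlib real numbers with Coquelicot's complex numbers, derivatives and
   integrals. *)
From Stdlib Require Import Reals ZArith.
From Coquelicot Require Import Coquelicot.

Open Scope R_scope.

Definition upper_half_plane (z : C) : Prop := 0 < Im z.

Record mat2 : Type := Mat2 { m11 : R; m12 : R; m21 : R; m22 : R }.

Definition det2 (g : mat2) : R := m11 g * m22 g - m12 g * m21 g.

Definition mat2_mul (g h : mat2) : mat2 :=
  Mat2 (m11 g * m11 h + m12 g * m21 h) (m11 g * m12 h + m12 g * m22 h)
       (m21 g * m11 h + m22 g * m21 h) (m21 g * m12 h + m22 g * m22 h).

Lemma det2_mul (g h : mat2) : det2 (mat2_mul g h) = det2 g * det2 h.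
Proof. unfold det2, mat2_mul; simpl; ring. Qed.

Definition SL2 : Type := { g : mat2 | det2 g = 1 }.

Definition SL2_mat (g : SL2) : mat2 := proj1_sig g.
Coercion SL2_mat : SL2 >-> mat2.

Lemma SL2_mul_det (g h : SL2) : det2 (mat2_mul g h) = 1.
Proof.
rewrite det2_mul; unfold SL2_mat.
rewrite (proj2_sig g), (proj2_sig h); ring.
Qed.

Definition SL2_mul (g h : SL2) : SL2 := exist _ (mat2_mul g h) (SL2_mul_det g h).

Definition automorphy (g : mat2) (z : C) : C := (RtoC (m21 g) * z + RtoC (m22 g))%C.

Definition mobius (g : mat2) (z : C) : C :=
  ((RtoC (m11 g) * z + RtoC (m12 g)) / automorphy g z)%C.

Definition Cexp (z : C) : C := (exp (Re z) * cos (Im z), exp (Re z) * sin (Im z)).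

Definition nome (z : C) : C := Cexp (2 * RtoC PI * Ci * z)%C.

Fixpoint Delta_prod (q : C) (N : nat) : C :=
  match N with
  | O => RtoC 1
  | S n => (Delta_prod q n * (1 - q ^ S n) ^ 24)%C
  end.

Definition Delta_infprod (q : C) : C :=
  (real (Lim_seq (fun N => Re (Delta_prod q N))),
   real (Lim_seq (fun N => Im (Delta_prod q N)))).

Definition Delta (z : C) : C :=
  ((2 * RtoC PI) ^ 12 * nome z * Delta_infprod (nome z))%C.

(* Meaningful for [0 < det2 g] and [z] in the upper half-plane. *)
Definition Delta_slash (g : mat2) (z : C) : C :=
  (RtoC (det2 g) ^ 6 * Delta (mobius g z) / automorphy g z ^ 12)%C.

Definition psi (g : mat2) (z : C) : C := (Delta_slash g z / Delta z)%C.

(* d/dz log f is the logarithmic derivative f'/f. *)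
Definition mu (g : mat2) (z : C) : C :=
  (/ (12 * RtoC PI * Ci) * (C_derive (psi g) z / psi g z))%C.

(* Integral along the straight segment from [a] to [b]. The upper half-plane
   is convex, and for a function holomorphic there this is the integral along
   any path in it. *)
Definition segment_int (f : C -> C) (a b : C) : C :=
  RInt (V := C_R_CompleteNormedModule)
    (fun t : R => (f (a + RtoC t * (b - a)) * (b - a))%C) 0 1.

Definition tau (z0 : C) (g1 g2 : SL2) : C :=
  segment_int (mu g1) z0 (mobius g2 z0).

Definition is_log_branch (f L : C -> C) : Prop :=
  forall z : C, upper_half_plane z -> continuous L z /\ Cexp (L z) = f z.

Section Cohomology.
Context {G : Type} (mul : G -> G -> G).

Definition coboundary1 (f : G -> R) (g1 g2 : G) : R :=
  f g2 - f (mul g1 g2) + f g1.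

Definition coboundary2 (c : G -> G -> R) (g1 g2 g3 : G) : R :=
  c g2 g3 - c (mul g1 g2) g3 + c g1 (mul g2 g3) - c g1 g2.

Definition is_cocycle2 (c : G -> G -> R) : Prop :=
  forall g1 g2 g3 : G, coboundary2 c g1 g2 g3 = 0.

Definition cohomologous2 (c c' : G -> G -> R) : Prop :=
  exists f : G -> R, forall g1 g2 : G, c g1 g2 - c' g1 g2 = coboundary1 f g1 g2.
End Cohomology.

(* Two nonzero vectors define the same point of P^1(R). *)
Definition same_line (u v : R * R) : Prop :=
  exists r : R, r <> 0 /\ fst u = r * fst v /\ snd u = r * snd v.

(* The universal covering R -> P^1(R), t |-> [sin (PI t) : cos (PI t)]. In the
   coordinate x = tan (PI t) it is increasing, so it respects the orientation
   of P^1(R) as the boundary of the upper half-plane; its deck group is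
   generated by t |-> t + 1. *)
Definition P1_cover (t : R) : R * R := (sin (PI * t), cos (PI * t)).

Definition mat2_vec (g : mat2) (v : R * R) : R * R :=
  (m11 g * fst v + m12 g * snd v, m21 g * fst v + m22 g * snd v).

(* The continuous lifts to R of the homeomorphisms of P^1(R) induced by
   SL(2,R) form, under composition, the universal covering group of
   PSL(2,R); the kernel Z of the projection consists of the translations by
   integers. *)
Definition is_lift (g : SL2) (phi : R -> R) : Prop :=
  (forall t : R, continuous phi t) /\
  (forall t : R, same_line (P1_cover (phi t)) (mat2_vec g (P1_cover t))).

(* [n] is the cocycle of that central extension, pulled back to SL(2,R), for
   the section [s]: s(g1) s(g2) = T^{n(g1,g2)} s(g1 g2), where T is the
   translation t |-> t + 1. *)
Definition is_extension_cocycle (s : SL2 -> R -> R) (n : SL2 -> SL2 -> Z) : Prop :=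
  (forall g : SL2, is_lift g (s g)) /\
  (forall (g1 g2 : SL2) (t : R), s g1 (s g2 t) = s (SL2_mul g1 g2) t + IZR (n g1 g2)).

(* The Euler class, as a set of 2-cocycles: an element of H^2(SL(2,R), R) is
   a coset of the coboundaries.

   Sign. Let [g1|g2] correspond to the geodesic triangle (z0, g1 z0, g1 g2 z0)
   in H, and let A(g1,g2) be its signed area for dx dy / y^2 = d(dx / y).
   With j(g,z) = m21 z + m22 one has g^*(dx/y) - dx/y = 2 d arg j(g,z), so,
   up to a coboundary, A(g1,g2) is 2 (arg j(g1, g2 z0) - arg j(g1, z0)) for a
   continuous branch of arg j(g1, _). The loop of rotations along which
   arg j(_, i) goes from 0 to 2 PI lifts to T^{-2}, whence n is cohomologous
   to - A / (2 PI). On the fundamental class of a closed surface of genus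
   g >= 2 uniformized by H, A evaluates to the area 2 PI (2 g - 2), and so n
   evaluates to the Euler characteristic 2 - 2 g. *)
Definition euler_class (c : SL2 -> SL2 -> R) : Prop :=
  is_cocycle2 SL2_mul c /\
  exists (s : SL2 -> R -> R) (n : SL2 -> SL2 -> Z),
    is_extension_cocycle s n /\
    cohomologous2 SL2_mul c (fun g1 g2 => IZR (n g1 g2)).

(* Main.v *)
(* No modularity of Delta is used, only that Delta = exp (log_Delta) on H with
   log_Delta holomorphic. The Cayley transform w = (z - i) / (z + i) conjugates
   g to an element of SU(1,1) with automorphy factor J(g,w) = p + r w, where
   |r| < |p|, so that log J(g,w) = log p + Log (1 + (r/p) w) is continuous on
   the closed disk. Since (m21 z + m22) (g z + i) = (z + i) J(g,w), a logarithm
   of psi_g(z) is Q(g z) - Q(z) - 12 log J(g,w) with Q a logarithm of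
   Delta(z) (z + i)^12, so Re tau is cohomologous to
   - (Im log J(g1, g2 w0) - Im log J(g1, w0)) / PI. On the boundary circle g
   acts by w |-> w conj(J) / J, so t - Im (log J(g,w_t)) / PI is a lift of g.
   The integer log J(g1, g2 w) + log J(g2, w) - log J(g1 g2, w), in units of
   2 PI i, does not depend on w in the closed disk: on the boundary it is the
   cocycle of the extension, inside it is Re tau, both up to the same factor
   and a coboundary. *)
Require Import Defs.
From Stdlib Require Import Reals ZArith Lra Lia ClassicalEpsilon.
From Coquelicot Require Import Coquelicot.
Open Scope R_scope.

(** The obstacle is that the two cocycles live in different places: [tau] is computed at an interior
    point of H, while the lifts act on the boundary, where Delta has no values. Only an automorphy
    factor can pass from one to the other, so all contributions of Delta have to be split off into a
    coboundary. The factor m21 z + m22 itself will not do: if m21 is nonzero, it has a zero and a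
    pole on P^1(R). The factor J has neither on the closed disk, and this is the reason for the
    Cayley transform.

    The logarithm of Delta is built from the product: every 1 - q^n lies in the right half-plane, so
    the principal branch applies to each factor. The sum of these logarithms need not be the
    principal logarithm of the product; it only has to exponentiate to it.

    The logarithms of J for different g are chosen independently of each other. The group is
    discrete, so no continuity in g is asked for, and another choice changes the integer cocycle by
    a coboundary. *)

(** * Complex differentiation *)

Lemma is_derive_C_iff (f : C -> C) (z l : C) :
  is_derive f z l <->
  (forall eps : posreal, exists delta : posreal, forall y : C,
     Cmod (y - z) < delta ->
     Cmod (f y - f z - l * (y - z)) <= eps * Cmod (y - z)).
Proof.
split.
- intros [_ H] eps.
  destruct (H z (fun P HP => HP) eps) as [d Hd].
  exists d; intros y Hy.
  rewrite (Cmult_comm l); exact (Hd y Hy).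
- intros H; split.
  + apply is_linear_scal_l.
  + intros x Hx eps.
    rewrite <- (is_filter_lim_locally_unique _ _ Hx).
    destruct (H eps) as [d Hd].
    exists d; intros y Hy.
    specialize (Hd y Hy); rewrite (Cmult_comm l) in Hd; exact Hd.
Qed.

(** The product and chain rules over an [AbsRing] use the module structure of the ring on itself,
    while C otherwise carries [C_NormedModule]. Both have the norm [Cmod], so the little-o condition
    transfers unchanged. *)
Lemma is_derive_C_AbsRing (f : C -> C) (z l : C) :
  is_derive (K := C_AbsRing) (V := AbsRing_NormedModule C_AbsRing) f z l <->
  is_derive f z l.
Proof.
split; intros [_ H]; (split; [apply is_linear_scal_l|exact H]).
Qed.

Lemma is_derive_C_mult (f g : C -> C) (z df dg : C) :
  is_derive f z df -> is_derive g z dg ->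
  is_derive (fun y => f y * g y)%C z (df * g z + f z * dg)%C.
Proof.
intros Hf Hg; apply is_derive_C_AbsRing.
apply (is_derive_mult (K := C_AbsRing)).
- now apply is_derive_C_AbsRing.
- now apply is_derive_C_AbsRing.
- intros n m; apply Cmult_comm.
Qed.

Lemma is_derive_C_comp (f g : C -> C) (z df dg : C) :
  is_derive f (g z) df -> is_derive g z dg ->
  is_derive (fun y => f (g y)) z (df * dg)%C.
Proof.
intros Hf Hg; rewrite Cmult_comm.
apply (is_derive_comp (K := C_AbsRing) (V := C_NormedModule) f g z df dg).
- exact Hf.
- now apply is_derive_C_AbsRing.
Qed.

Lemma is_derive_C_eq (f : C -> C) (z l l' : C) :
  is_derive f z l -> l = l' -> is_derive f z l'.
Proof. now intros H <-. Qed.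

Lemma is_derive_C_id (z : C) : is_derive (fun y : C => y) z (RtoC 1).
Proof. apply is_derive_C_AbsRing, (is_derive_id (K := C_AbsRing)). Qed.

Lemma is_derive_C_const (c z : C) : is_derive (fun _ : C => c) z (RtoC 0).
Proof. apply (is_derive_const (K := C_AbsRing) (V := C_NormedModule)). Qed.

Lemma is_derive_C_plus (f g : C -> C) (z df dg : C) :
  is_derive f z df -> is_derive g z dg ->
  is_derive (fun y => f y + g y)%C z (df + dg)%C.
Proof. apply (is_derive_plus (K := C_AbsRing) (V := C_NormedModule)). Qed.

Lemma is_derive_C_minus (f g : C -> C) (z df dg : C) :
  is_derive f z df -> is_derive g z dg ->
  is_derive (fun y => f y - g y)%C z (df - dg)%C.
Proof. apply (is_derive_minus (K := C_AbsRing) (V := C_NormedModule)). Qed.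

Lemma is_derive_C_scal (c : C) (f : C -> C) (z df : C) :
  is_derive f z df -> is_derive (fun y => c * f y)%C z (c * df)%C.
Proof.
intros H; eapply is_derive_C_eq.
- exact (is_derive_C_mult (fun _ => c) f z _ _ (is_derive_C_const c z) H).
- cbv beta; ring.
Qed.

Lemma is_derive_C_continuous (f : C -> C) (z l : C) :
  is_derive f z l -> continuous f z.
Proof.
intros H P HP.
apply (locally_C z), (ex_derive_continuous (K := C_AbsRing) (V := C_NormedModule)).
- now exists l.
- exact HP.
Qed.

Lemma Cmod_le_abs (z : C) : Cmod z <= Rabs (Re z) + Rabs (Im z).
Proof.
destruct z as [x y]; unfold Cmod; simpl.
apply Rsqr_incr_0_var.
- rewrite Rsqr_sqrt by nra.
  pose proof (Rabs_pos x); pose proof (Rabs_pos y).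
  unfold Rsqr.
  assert (Rabs x * Rabs x = x * x) by (rewrite <- Rabs_mult; apply Rabs_pos_eq; nra).
  assert (Rabs y * Rabs y = y * y) by (rewrite <- Rabs_mult; apply Rabs_pos_eq; nra).
  nra.
- pose proof (Rabs_pos x); pose proof (Rabs_pos y); lra.
Qed.

Lemma im_le_Cmod (z : C) : Rabs (Im z) <= Cmod z.
Proof. eapply Rle_trans; [apply Rmax_r|apply Rmax_Cmod]. Qed.

Lemma continuous_C_iff (f : C -> C) (z : C) :
  continuous f z <->
  (forall eps : posreal, exists delta : posreal, forall y : C,
     Cmod (y - z) < delta -> Cmod (f y - f z) < eps).
Proof.
split.
- intros H eps.
  assert (H1 : locally z (fun y => Cmod (f y - f z) < eps)).
  { apply (H (fun w => Cmod (w - f z) < eps)), (locally_C (f z)).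
    exists eps; intros y Hy; exact Hy. }
  apply (locally_C z) in H1; destruct H1 as [d Hd].
  exists d; intros y Hy; now apply Hd.
- intros H; apply (filterlim_locally (F := locally z)); intros eps.
  apply (locally_C z); destruct (H eps) as [d Hd].
  exists d; intros y Hy.
  apply C_NormedModule_mixin_compat1, Hd, Hy.
Qed.

Lemma is_derive_C_inv (z : C) : z <> 0 -> is_derive Cinv z (- / (z * z))%C.
Proof.
intros Hz; apply is_derive_C_iff; intros eps.
pose proof (proj1 (Cmod_gt_0 z) Hz) as Hm.
set (m := Cmod z) in *.
(* The remainder is (y - z)^2 / (y z^2). The first bound keeps |y| above m / 2; the second then
   makes |y - z| / (|y| m^2) smaller than [eps]. *)
assert (Hd : 0 < Rmin (m / 2) (eps * (m * m * m) / 2)).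
{ pose proof (cond_pos eps).
  apply Rmin_pos; [lra|].
  assert (0 < eps * (m * m * m)) by (repeat apply Rmult_lt_0_compat; lra). lra. }
exists (mkposreal _ Hd); intros y Hy; simpl in Hy.
assert (H1 : Cmod (y - z) < m / 2) by (eapply Rlt_le_trans; [exact Hy|apply Rmin_l]).
assert (H2 : Cmod (y - z) < eps * (m * m * m) / 2)
  by (eapply Rlt_le_trans; [exact Hy|apply Rmin_r]).
assert (Hym : m / 2 < Cmod y).
{ assert (m <= Cmod y + Cmod (y - z)).
  { unfold m; replace z with (y + - (y - z))%C at 1 by ring.
    eapply Rle_trans; [apply Cmod_triangle|rewrite Cmod_opp; lra]. }
  lra. }
assert (Hy0 : y <> 0) by (apply Cmod_gt_0; lra).
replace (/ y - / z - - / (z * z) * (y - z))%C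
  with ((y - z) * ((y - z) / (y * (z * z))))%C by (now field).
rewrite Cmod_mult, Rmult_comm.
apply Rmult_le_compat_r; [apply Cmod_ge_0|].
rewrite Cmod_div, !Cmod_mult by (repeat apply Cmult_neq_0; assumption).
fold m.
apply Rle_div_l; [repeat apply Rmult_lt_0_compat; lra|].
pose proof (cond_pos eps).
assert (0 < eps * (m * m)) by (repeat apply Rmult_lt_0_compat; lra).
nra.
Qed.

Lemma is_derive_C_div (f g : C -> C) (z df dg : C) :
  is_derive f z df -> is_derive g z dg -> g z <> 0 ->
  is_derive (fun y => f y / g y)%C z ((df * g z - f z * dg) / (g z * g z))%C.
Proof.
intros Hf Hg H0; eapply is_derive_C_eq.
- exact (is_derive_C_mult f (fun y => / g y)%C z _ _ Hf
    (is_derive_C_comp Cinv g z _ _ (is_derive_C_inv _ H0) Hg)).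
- cbv beta; now field.
Qed.

Lemma norm_C_R (x : C) : norm (V := C_R_NormedModule) x = Cmod x.
Proof.
unfold norm; simpl; unfold prod_norm, Cmod, norm; simpl; unfold abs; simpl.
f_equal; rewrite !Rmult_1_r, <- !Rabs_mult, !Rabs_pos_eq by nra; ring.
Qed.

(** Passes from complex derivatives to derivatives in a real parameter, to which the real mean value
    theorem and [RInt] apply. *)
Lemma is_derive_along_line (f : C -> C) (a b l : C) (t : R) :
  is_derive f (a + RtoC t * b)%C l ->
  is_derive (V := C_R_NormedModule) (fun s : R => f (a + RtoC s * b)%C) t (l * b)%C.
Proof.
intros H; split; [apply is_linear_scal_l|].
intros x Hx eps; rewrite <- (is_filter_lim_locally_unique _ _ Hx); clear x Hx.
(* The added 1 covers the degenerate segment [b = 0]. *)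
assert (Hb : 0 < Cmod b + 1) by (pose proof (Cmod_ge_0 b); lra).
assert (He : 0 < eps / (Cmod b + 1)) by (apply Rdiv_lt_0_compat; [apply cond_pos|exact Hb]).
destruct (proj1 (is_derive_C_iff _ _ _) H (mkposreal _ He)) as [d Hd].
assert (Hd' : 0 < d / (Cmod b + 1)) by (apply Rdiv_lt_0_compat; [apply cond_pos|exact Hb]).
exists (mkposreal _ Hd'); intros s Hs.
assert (Hs' : Rabs (s - t) < d / (Cmod b + 1)) by exact Hs; clear Hs.
assert (Hm : Cmod (a + RtoC s * b - (a + RtoC t * b)) = Rabs (s - t) * Cmod b).
{ rewrite <- Cmod_R, <- Cmod_mult; f_equal; rewrite RtoC_minus; ring. }
specialize (Hd (a + RtoC s * b)%C); rewrite Hm in Hd; simpl in Hd.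
rewrite norm_C_R.
match goal with |- Cmod ?x <= _ =>
  replace x with (f (a + RtoC s * b) - f (a + RtoC t * b)
     - l * (a + RtoC s * b - (a + RtoC t * b)))%C end.
2: { apply injective_projections; simpl; unfold minus, plus, opp, scal; simpl;
     unfold mult; simpl; ring. }
pose proof (Cmod_ge_0 b); pose proof (Rabs_pos (s - t)).
eapply Rle_trans.
- apply Hd; apply Rle_lt_trans with (Rabs (s - t) * (Cmod b + 1)); [nra|].
  apply Rlt_div_r in Hs'; lra.
- change (norm (minus s t)) with (Rabs (s - t)).
  assert (Cmod b / (Cmod b + 1) <= 1) by (apply Rle_div_l; lra).
  pose proof (cond_pos eps).
  replace (eps / (Cmod b + 1) * (Rabs (s - t) * Cmod b))
    with (eps * Rabs (s - t) * (Cmod b / (Cmod b + 1))) by (field; lra).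
  assert (0 <= eps * Rabs (s - t)) by nra.
  nra.
Qed.

Lemma is_derive_C_R_Re (f : R -> C) (t : R) (l : C) :
  is_derive (V := C_R_NormedModule) f t l -> is_derive (fun s => Re (f s)) t (Re l).
Proof.
intros H; split; [apply is_linear_scal_l|].
intros x Hx eps; destruct (proj2 H x Hx eps) as [d Hd].
exists d; intros s Hs; specialize (Hd s Hs); rewrite norm_C_R in Hd.
eapply Rle_trans; [|exact Hd].
eapply Rle_trans; [|apply re_le_Cmod].
apply Req_le; reflexivity.
Qed.

Lemma is_derive_C_R_Im (f : R -> C) (t : R) (l : C) :
  is_derive (V := C_R_NormedModule) f t l -> is_derive (fun s => Im (f s)) t (Im l).
Proof.
intros H; split; [apply is_linear_scal_l|].
intros x Hx eps; destruct (proj2 H x Hx eps) as [d Hd].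
exists d; intros s Hs; specialize (Hd s Hs); rewrite norm_C_R in Hd.
eapply Rle_trans; [|exact Hd].
eapply Rle_trans; [|apply im_le_Cmod].
apply Req_le; reflexivity.
Qed.

(** The mean value theorem fails for complex values, so it is applied to real and imaginary parts
    separately; adding the two bounds costs the factor 2. *)
Lemma C_mean_value_bound (f f' : C -> C) (a b : C) (M : R) :
  (forall t, 0 <= t <= 1 ->
     is_derive f (a + RtoC t * (b - a))%C (f' (a + RtoC t * (b - a))%C) /\
     Cmod (f' (a + RtoC t * (b - a))%C) <= M) ->
  Cmod (f b - f a) <= 2 * M * Cmod (b - a).
Proof.
intros H.
assert (Hr : forall P : C -> R, (forall z, Rabs (P z) <= Cmod z) ->
   (forall x y, P (x - y)%C = P x - P y) ->
   (forall (g : R -> C) (t : R) (l : C),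
      is_derive (V := C_R_NormedModule) g t l -> is_derive (fun s => P (g s)) t (P l)) ->
   Rabs (P (f b - f a)%C) <= M * Cmod (b - a)).
{ intros P HP Hlin Hder.
  set (g := fun t : R => f (a + RtoC t * (b - a))%C).
  assert (Hg : forall t, 0 <= t <= 1 ->
    is_derive (fun t => P (g t)) t (P (f' (a + RtoC t * (b - a)) * (b - a))%C)).
  { intros t Ht; apply Hder, is_derive_along_line, H, Ht. }
  destruct (MVT_gen (fun t => P (g t)) 0 1
    (fun t => P (f' (a + RtoC t * (b - a)) * (b - a))%C)) as [c [Hc Hv]].
  - intros t Ht; rewrite Rmin_left, Rmax_right in Ht by lra; apply Hg; lra.
  - intros t Ht; rewrite Rmin_left, Rmax_right in Ht by lra.
    apply continuity_pt_filterlim, (ex_derive_continuous (fun t => P (g t))).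
    eexists; apply Hg, Ht.
  - rewrite Rmin_left, Rmax_right in Hc by lra.
    unfold g in Hv.
    replace (a + RtoC 1 * (b - a))%C with b in Hv by ring.
    replace (a + RtoC 0 * (b - a))%C with a in Hv by ring.
    rewrite Hlin, Hv, Rminus_0_r, Rmult_1_r.
    eapply Rle_trans; [apply HP|]; rewrite Cmod_mult.
    apply Rmult_le_compat_r; [apply Cmod_ge_0|now apply H]. }
eapply Rle_trans; [apply Cmod_le_abs|].
pose proof (Hr Re re_le_Cmod (fun x y => eq_refl) is_derive_C_R_Re).
pose proof (Hr Im im_le_Cmod (fun x y => eq_refl) is_derive_C_R_Im).
lra.
Qed.

(** * The exponential and logarithms *)

Lemma Cexp_plus (x y : C) : Cexp (x + y) = (Cexp x * Cexp y)%C.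
Proof.
unfold Cexp; destruct x as [a b], y as [c d]; simpl.
rewrite exp_plus, cos_plus, sin_plus.
apply injective_projections; simpl; ring.
Qed.

Lemma Cexp_0 : Cexp 0 = 1.
Proof.
unfold Cexp; simpl; rewrite exp_0, cos_0, sin_0.
apply injective_projections; simpl; ring.
Qed.

Lemma Cmod_Cexp (z : C) : Cmod (Cexp z) = exp (Re z).
Proof.
unfold Cexp, Cmod; simpl.
replace (_ + _) with (exp (Re z) * exp (Re z)).
- apply sqrt_square, Rlt_le, exp_pos.
- pose proof (sin2_cos2 (Im z)) as H; unfold Rsqr in H.
  transitivity (exp (Re z) * exp (Re z) * (sin (Im z) * sin (Im z) + cos (Im z) * cos (Im z)));
  [rewrite H; ring|ring].
Qed.

Lemma Cexp_neq_0 (z : C) : Cexp z <> 0.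
Proof. apply Cmod_gt_0; rewrite Cmod_Cexp; apply exp_pos. Qed.

Lemma Cexp_opp (z : C) : Cexp (- z) = (/ Cexp z)%C.
Proof.
pose proof (Cexp_neq_0 z).
assert (Cexp (- z) * Cexp z = 1)%C.
{ rewrite <- Cexp_plus; replace (- z + z)%C with (RtoC 0) by ring; apply Cexp_0. }
transitivity ((Cexp (- z) * Cexp z) / Cexp z)%C; [now field|].
rewrite H0; now field.
Qed.

Lemma Cexp_minus (x y : C) : Cexp (x - y) = (Cexp x / Cexp y)%C.
Proof. unfold Cminus; rewrite Cexp_plus, Cexp_opp; reflexivity. Qed.

Lemma Cexp_mult_INR (n : nat) (z : C) : Cexp (INR n * z) = (Cexp z ^ n)%C.
Proof.
induction n as [|n IH].
- simpl Cpow; replace (RtoC (INR 0) * z)%C with (RtoC 0) by (simpl; ring); apply Cexp_0.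
- rewrite S_INR, RtoC_plus.
  replace ((INR n + 1) * z)%C with (INR n * z + z)%C by ring.
  rewrite Cexp_plus, IH; simpl; ring.
Qed.

Lemma Cexp_eq_1 (z : C) : Cexp z = 1 -> exists k : Z, z = (2 * PI * IZR k * Ci)%C.
Proof.
intros H.
assert (Hr : Re z = 0).
{ apply exp_inv; rewrite <- Cmod_Cexp, H, Cmod_1, exp_0; reflexivity. }
unfold Cexp in H; rewrite Hr, exp_0 in H; injection H; intros Hs Hc.
rewrite Rmult_1_l in Hs, Hc.
(* The half angle excludes odd multiples of PI: [cos (Im z) = 1] forces [sin (Im z / 2) = 0]. *)
destruct (sin_eq_0_0 (Im z / 2)) as [k Hk].
{ replace (Im z) with (2 * (Im z / 2)) in Hc by field.
  rewrite cos_2a_sin in Hc; nra. }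
exists k; destruct z as [x y]; simpl in *.
apply injective_projections; simpl; lra.
Qed.

Lemma one_minus_cos_le (y : R) : 0 <= 1 - cos y <= y * y / 2.
Proof.
replace y with (2 * (y / 2)) at 1 2 by field.
rewrite cos_2a_sin.
assert (H : Rabs (sin (y / 2)) <= Rabs (y / 2)).
{ assert (Hp : forall x, 0 < x -> Rabs (sin x) <= x).
  { intros x Hx; apply Rabs_le; split.
    - destruct (Rle_lt_dec x 1) as [H1|H1].
      + pose proof PI2_1; pose proof (sin_ge_0 x); lra.
      + pose proof (SIN_bound x); lra.
    - apply Rlt_le, sin_lt_x, Hx. }
  destruct (Rtotal_order (y / 2) 0) as [H|[H|H]].
  - rewrite <- Rabs_Ropp, <- sin_neg, <- (Rabs_Ropp (y / 2)).
    rewrite (Rabs_pos_eq (- (y / 2))) by lra; apply Hp; lra.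
  - rewrite H, sin_0; lra.
  - rewrite (Rabs_pos_eq (y / 2)) by lra; now apply Hp. }
apply Rsqr_le_abs_1 in H; unfold Rsqr in H.
pose proof (Rle_0_sqr (sin (y / 2))) as H0; unfold Rsqr in H0; nra.
Qed.

Lemma sin_minus_id_le (y : R) : Rabs y <= 1 -> Rabs (sin y - y) <= y * y.
Proof.
intros Hy.
destruct (MVT_gen (fun t => sin t - t) 0 y (fun t => cos t - 1)) as [c [Hc Hv]].
- intros t _; auto_derive; [easy|ring].
- intros t _; apply continuity_pt_minus; [apply continuity_sin|apply continuity_pt_id].
- cbv beta in Hv; rewrite sin_0 in Hv.
  replace (sin y - y) with ((cos c - 1) * y) by lra.
  assert (Hcy : c * c <= y * y).
  { revert Hc; unfold Rmin, Rmax; destruct (Rle_dec 0 y); intros; nra. }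
  rewrite Rabs_mult, <- Rabs_Ropp.
  pose proof (one_minus_cos_le c).
  rewrite Rabs_pos_eq by lra.
  pose proof (Rabs_pos y).
  nra.
Qed.

(** The upper bound comes from the tangent inequality at -x: it gives exp x <= 1 / (1 - x), and 1 /
    (1 - x) - 1 - x = x^2 / (1 - x). *)
Lemma exp_taylor1 (x : R) : Rabs x <= 1 / 2 -> 0 <= exp x - 1 - x <= 2 * (x * x).
Proof.
intros Hx; apply Rabs_le_between in Hx.
pose proof (exp_ineq1_le x); split; [lra|].
pose proof (exp_ineq1_le (- x)) as H1; rewrite exp_Ropp in H1.
pose proof (exp_pos x) as H2.
assert (exp x * (1 - x) <= 1).
{ apply Rmult_le_reg_l with (/ exp x); [now apply Rinv_0_lt_compat|].
  rewrite <- Rmult_assoc, Rinv_l; lra. }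
nra.
Qed.

(** The constant is 3 + 7, from crude bounds on the real and the imaginary part. *)
Lemma Cexp_taylor1 (h : C) : Cmod h <= 1 / 2 ->
  Cmod (Cexp h - 1 - h) <= 10 * (Cmod h * Cmod h).
Proof.
intros Hh.
pose proof (re_le_Cmod h) as Hx; pose proof (im_le_Cmod h) as Hy.
destruct h as [x y]; unfold Cexp; simpl Re in *; simpl Im in *.
set (m := Cmod (x, y)) in *.
eapply Rle_trans; [apply Cmod_le_abs|]; simpl.
assert (Hxx : x * x <= m * m).
{ rewrite <- (Rabs_pos_eq (x * x)), Rabs_mult by nra; pose proof (Rabs_pos x); nra. }
assert (Hyy : y * y <= m * m).
{ rewrite <- (Rabs_pos_eq (y * y)), Rabs_mult by nra; pose proof (Rabs_pos y); nra. }
assert (Hxy : Rabs (x * y) <= m * m).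
{ rewrite Rabs_mult; pose proof (Rabs_pos x); pose proof (Rabs_pos y); nra. }
pose proof (exp_taylor1 x ltac:(lra)) as He.
pose proof (one_minus_cos_le y) as Hc.
pose proof (sin_minus_id_le y ltac:(lra)) as Hs.
assert (He2 : 0 < exp x <= 2).
{ split; [apply exp_pos|]; apply Rabs_le_between in Hx; nra. }
assert (Rabs (exp x * cos y + - (1) + - x) <= 3 * (m * m)).
{ replace (exp x * cos y + - (1) + - x)
    with ((exp x - 1 - x) + exp x * - (1 - cos y)) by ring.
  apply Rabs_le; split; nra. }
assert (Rabs (exp x * sin y + - 0 + - y) <= 7 * (m * m)).
{ replace (exp x * sin y + - 0 + - y)
    with (exp x * (sin y - y) + (x * y + (exp x - 1 - x) * y)) by ring.
  eapply Rle_trans; [apply Rabs_triang|].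
  assert (Rabs (exp x * (sin y - y)) <= 2 * (m * m)).
  { rewrite Rabs_mult, Rabs_pos_eq by lra.
    pose proof (Rabs_pos (sin y - y)); nra. }
  assert (Rabs ((exp x - 1 - x) * y) <= 2 * (m * m)).
  { rewrite Rabs_mult, Rabs_pos_eq by lra.
    pose proof (Rabs_pos y); nra. }
  pose proof (Rabs_triang (x * y) ((exp x - 1 - x) * y)); lra. }
lra.
Qed.

Lemma is_derive_Cexp (z : C) : is_derive Cexp z (Cexp z).
Proof.
apply is_derive_C_iff; intros eps.
pose proof (Cexp_neq_0 z) as H0; apply Cmod_gt_0 in H0.
set (m := Cmod (Cexp z)) in *.
pose proof (cond_pos eps).
assert (Hd : 0 < Rmin (1 / 2) (eps / (10 * m))).
{ apply Rmin_pos; [lra|apply Rdiv_lt_0_compat; lra]. }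
exists (mkposreal _ Hd); intros y Hy; simpl in Hy.
pose proof (Rlt_le_trans _ _ _ Hy (Rmin_l _ _)).
pose proof (Rlt_le_trans _ _ _ Hy (Rmin_r _ _)) as H2.
replace y with (z + (y - z))%C at 1 by ring.
rewrite Cexp_plus.
replace (Cexp z * Cexp (y - z) - Cexp z - Cexp z * (y - z))%C
  with (Cexp z * (Cexp (y - z) - 1 - (y - z)))%C by ring.
rewrite Cmod_mult; fold m.
pose proof (Cexp_taylor1 (y - z) ltac:(lra)) as H3.
apply Rlt_div_r in H2; [|lra].
pose proof (Cmod_ge_0 (y - z)).
apply Rle_trans with (m * (10 * (Cmod (y - z) * Cmod (y - z)))).
- apply Rmult_le_compat_l; lra.
- nra.
Qed.

(* The principal branch, meaningful only for [0 < Re z]. *)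
Definition Clog (z : C) : C := (ln (Cmod z), atan (Im z / Re z)).

Lemma Cexp_Clog (z : C) : 0 < Re z -> Cexp (Clog z) = z.
Proof.
intros Hz; destruct z as [x y]; simpl in Hz.
unfold Cexp, Clog; simpl Re; simpl Im.
assert (Hs : Cmod (x, y) = x * sqrt (1 + (y / x)²)).
{ unfold Cmod; simpl.
  replace (x * (x * 1) + y * (y * 1)) with (x * x * (1 + (y / x)²))
    by (unfold Rsqr; field; lra).
  rewrite sqrt_mult_alt, sqrt_square by nra; reflexivity. }
assert (Hp : 0 < sqrt (1 + (y / x)²)).
{ apply sqrt_lt_R0; pose proof (Rle_0_sqr (y / x)); lra. }
rewrite exp_ln, Hs, cos_atan, sin_atan by (rewrite Hs; nra).
apply injective_projections; simpl; field; lra.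
Qed.

Lemma Clog_1 : Clog 1 = 0.
Proof.
unfold Clog; rewrite Cmod_1, ln_1; simpl.
unfold Rdiv; rewrite Rmult_0_l, atan_0; reflexivity.
Qed.

Lemma continuous_Clog (z : C) : 0 < Re z -> continuous Clog z.
Proof.
intros Hz; assert (Hm : 0 < Cmod z).
{ apply Cmod_gt_0; intros ->; simpl in Hz; lra. }
assert (H1 : continuous (fun w => ln (Cmod w)) z).
{ apply (continuous_comp Cmod ln).
  - apply (filterlim_norm (K := C_AbsRing) (V := C_NormedModule)).
  - apply (ex_derive_continuous (K := R_AbsRing) (V := R_NormedModule)); eexists; now apply is_derive_ln. }
assert (H2 : continuous (fun w : C => atan (Im w / Re w)) z).
{ destruct z as [x y]; apply (continuous_comp (fun w : C => Im w / Re w) atan).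
  - apply (continuous_mult (K := R_AbsRing) (fun w : C => Im w) (fun w : C => / Re w)).
    + apply continuous_snd.
    + apply (continuous_comp (fun w : C => Re w) Rinv).
      * apply continuous_fst.
      * apply (ex_derive_continuous (K := R_AbsRing) (V := R_NormedModule)); auto_derive; simpl in *; lra.
  - apply (ex_derive_continuous (K := R_AbsRing) (V := R_NormedModule)); auto_derive; trivial. }
unfold Clog.
intros P [e HP].
specialize (H1 (fun y => ball (ln (Cmod z)) e y) (locally_ball _ e)).
specialize (H2 (fun y => ball (atan (Im z / Re z)) e y) (locally_ball _ e)).
unfold filtermap in *.
generalize (filter_and _ _ H1 H2); apply filter_imp; intros w [A B].
apply HP; split; assumption.
Qed.

(** An inverse function argument: with k = Clog y - Clog z, differentiability of [Cexp] at Clog z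
    says that y - z is z k up to o(k), and continuity of [Clog] makes k small. *)
Lemma is_derive_Clog (z : C) : 0 < Re z -> is_derive Clog z (/ z)%C.
Proof.
intros Hz; assert (H0 : z <> 0) by (intros ->; simpl in Hz; lra).
pose proof (proj1 (Cmod_gt_0 z) H0) as Hm; set (m := Cmod z) in *.
apply is_derive_C_iff; intros eps; pose proof (cond_pos eps).
(* The first bound yields m |k| <= 2 |y - z|, which turns an error small against k into one small
   against y - z; the second is then calibrated to give [eps]. *)
assert (He : 0 < Rmin (m / 2) (eps * (m * m) / 2)).
{ apply Rmin_pos; [lra|].
  assert (0 < eps * (m * m)) by (repeat apply Rmult_lt_0_compat; lra). lra. }
destruct (proj1 (is_derive_C_iff _ _ _) (is_derive_Cexp (Clog z)) (mkposreal _ He))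
  as [d1 Hd1].
destruct (proj1 (continuous_C_iff _ _) (continuous_Clog z Hz) d1) as [d2 Hd2].
assert (Hd : 0 < Rmin d2 (Re z)) by (apply Rmin_pos; [apply cond_pos|exact Hz]).
exists (mkposreal _ Hd); intros y Hy; simpl in Hy.
assert (Hy1 : Cmod (y - z) < d2) by (eapply Rlt_le_trans; [exact Hy|apply Rmin_l]).
assert (Hy2 : 0 < Re y).
{ pose proof (Rlt_le_trans _ _ _ Hy (Rmin_r _ _)) as H1.
  pose proof (re_le_Cmod (y - z)) as H2.
  apply Rabs_le_between in H2; destruct y, z; simpl in *; lra. }
specialize (Hd1 _ (Hd2 y Hy1)); simpl in Hd1.
rewrite !Cexp_Clog in Hd1 by assumption.
set (k := (Clog y - Clog z)%C) in *.
assert (B1 : Cmod (y - z - z * k) <= m / 2 * Cmod k).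
{ eapply Rle_trans; [exact Hd1|].
  apply Rmult_le_compat_r; [apply Cmod_ge_0|apply Rmin_l]. }
assert (B2 : Cmod (y - z - z * k) <= eps * (m * m) / 2 * Cmod k).
{ eapply Rle_trans; [exact Hd1|].
  apply Rmult_le_compat_r; [apply Cmod_ge_0|apply Rmin_r]. }
assert (Hk : m * Cmod k <= 2 * Cmod (y - z)).
{ assert (m * Cmod k <= Cmod (y - z) + Cmod (y - z - z * k)).
  { unfold m; rewrite <- Cmod_mult, <- (Cmod_opp (y - z - z * k)).
    replace (z * k)%C with ((y - z) + - (y - z - z * k))%C at 1 by ring.
    apply Cmod_triangle. }
  lra. }
replace (k - / z * (y - z))%C with (- (y - z - z * k) / z)%C by (now field).
rewrite Cmod_div, Cmod_opp by assumption; fold m.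
apply Rle_div_l; [exact Hm|].
eapply Rle_trans; [exact B2|].
replace (eps * (m * m) / 2 * Cmod k) with (eps * m / 2 * (m * Cmod k)) by field.
replace (eps * Cmod (y - z) * m) with (eps * m / 2 * (2 * Cmod (y - z))) by field.
apply Rmult_le_compat_l; [|exact Hk].
assert (0 < eps * m) by (apply Rmult_lt_0_compat; lra). lra.
Qed.

(** Multiplication by one of 1, -1, Ci, -Ci moves z into the right half-plane, where [Clog] is a
    logarithm; each of these four units is itself an exponential. *)
Lemma Cexp_surj (z : C) : z <> 0 -> exists l : C, Cexp l = z.
Proof.
intros Hz.
assert (Hrot : forall u : C, 0 < Re (z * u) ->
  (exists v, Cexp v = u) -> exists l, Cexp l = z).
{ intros u Hu [v Hv]; exists (Clog (z * u) - v)%C.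
  rewrite Cexp_minus, Cexp_Clog, Hv by exact Hu.
  field; rewrite <- Hv; apply Cexp_neq_0. }
assert (Hc : forall x, exists v, Cexp v = (cos x, sin x)).
{ intros x; exists (0, x); unfold Cexp; simpl; rewrite exp_0, !Rmult_1_l; reflexivity. }
destruct z as [x y].
destruct (Rtotal_order x 0) as [H|[H|H]].
- apply (Hrot (cos PI, sin PI)); [|apply Hc].
  rewrite cos_PI, sin_PI; simpl; lra.
- assert (y <> 0) by (intros ->; apply Hz; rewrite H; reflexivity).
  destruct (Rtotal_order y 0) as [H1|[H1|H1]]; [|lra|].
  + apply (Hrot (cos (PI / 2), sin (PI / 2))); [|apply Hc].
    rewrite cos_PI2, sin_PI2; simpl; lra.
  + apply (Hrot (cos (- (PI / 2)), sin (- (PI / 2)))); [|apply Hc].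
    rewrite cos_neg, sin_neg, cos_PI2, sin_PI2; simpl; lra.
- apply (Hrot (cos 0, sin 0)); [|apply Hc].
  rewrite cos_0, sin_0; simpl; lra.
Qed.

(** * Series of holomorphic functions *)

(** Componentwise, like the limits in [Delta_infprod], so that the two can be compared through real
    series. *)
Definition CSeries (u : nat -> C) : C :=
  (Series (fun n => Re (u n)), Series (fun n => Im (u n))).

Definition Csummable (u : nat -> C) : Prop := ex_series (fun n => Cmod (u n)).

Lemma Csummable_le (u : nat -> C) (M : nat -> R) :
  (forall n, Cmod (u n) <= M n) -> ex_series M -> Csummable u.
Proof.
intros H HM; apply (ex_series_le (V := R_CompleteNormedModule) _ M); [|exact HM].
intros n; unfold norm; simpl; unfold abs; simpl.
rewrite Rabs_pos_eq; [apply H|apply Cmod_ge_0].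
Qed.

Lemma Csummable_Re (u : nat -> C) : Csummable u -> ex_series (fun n => Re (u n)).
Proof.
apply (ex_series_le (V := R_CompleteNormedModule)); intros n; apply re_le_Cmod.
Qed.

Lemma Csummable_Im (u : nat -> C) : Csummable u -> ex_series (fun n => Im (u n)).
Proof.
apply (ex_series_le (V := R_CompleteNormedModule)); intros n; apply im_le_Cmod.
Qed.

Lemma Csummable_minus (u v : nat -> C) :
  Csummable u -> Csummable v -> Csummable (fun n => u n - v n)%C.
Proof.
intros Hu Hv; apply (Csummable_le _ (fun n => Cmod (u n) + Cmod (v n))).
- intros n; rewrite <- (Cmod_opp (v n)); apply Cmod_triangle.
- exact (ex_series_plus _ _ Hu Hv).
Qed.

Lemma Csummable_scal (c : C) (u : nat -> C) :
  Csummable u -> Csummable (fun n => c * u n)%C.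
Proof.
intros Hu; apply (Csummable_le _ (fun n => Cmod c * Cmod (u n))).
- intros n; rewrite Cmod_mult; apply Rle_refl.
- exact (ex_series_scal (Cmod c) _ Hu).
Qed.

Lemma CSeries_minus (u v : nat -> C) : Csummable u -> Csummable v ->
  CSeries (fun n => u n - v n)%C = (CSeries u - CSeries v)%C.
Proof.
intros Hu Hv; apply injective_projections; simpl.
- exact (Series_minus _ _ (Csummable_Re u Hu) (Csummable_Re v Hv)).
- exact (Series_minus _ _ (Csummable_Im u Hu) (Csummable_Im v Hv)).
Qed.

Lemma CSeries_scal (c : C) (u : nat -> C) : Csummable u ->
  CSeries (fun n => c * u n)%C = (c * CSeries u)%C.
Proof.
intros Hu; pose proof (Csummable_Re u Hu) as Hr; pose proof (Csummable_Im u Hu) as Hi.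
apply injective_projections; simpl; rewrite <- !Series_scal_l.
- rewrite <- Series_minus; [reflexivity| |].
  + exact (ex_series_scal (fst c) _ Hr).
  + exact (ex_series_scal (snd c) _ Hi).
- rewrite <- Series_plus; [reflexivity| |].
  + exact (ex_series_scal (fst c) _ Hi).
  + exact (ex_series_scal (snd c) _ Hr).
Qed.

Lemma Cmod_CSeries_le (u : nat -> C) (M : nat -> R) :
  (forall n, Cmod (u n) <= M n) -> ex_series M -> Cmod (CSeries u) <= 2 * Series M.
Proof.
intros H HM.
assert (Hr : forall P : C -> R, (forall z, Rabs (P z) <= Cmod z) ->
  Rabs (Series (fun n => P (u n))) <= Series M).
{ intros P HP.
  assert (Hb : forall n, 0 <= Rabs (P (u n)) <= M n).
  { intros n; split; [apply Rabs_pos|].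
    eapply Rle_trans; [apply HP|apply H]. }
  eapply Rle_trans; [apply Series_Rabs|now apply Series_le].
  apply (ex_series_le (V := R_CompleteNormedModule) _ M); [|exact HM].
  intros n; unfold norm; simpl; unfold abs; simpl.
  rewrite Rabs_Rabsolu; apply Hb. }
eapply Rle_trans; [apply Cmod_le_abs|].
pose proof (Hr Re re_le_Cmod); pose proof (Hr Im im_le_Cmod).
unfold CSeries; simpl; simpl in *; lra.
Qed.

Definition C_convex (D : C -> Prop) : Prop :=
  forall a b t, D a -> D b -> 0 <= t <= 1 -> D (a + RtoC t * (b - a))%C.

Definition C_open (D : C -> Prop) : Prop :=
  forall z, D z -> exists delta : posreal, forall y, Cmod (y - z) < delta -> D y.

(* The bound on [u''] makes the Taylor remainders of the terms quadratic, with a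
   summable constant, so that they can be added up. *)
Lemma is_derive_CSeries (D : C -> Prop) (u u' u'' : nat -> C -> C) (M : nat -> R) :
  C_convex D -> C_open D -> ex_series M ->
  (forall n z, D z ->
     Cmod (u n z) <= M n /\ Cmod (u' n z) <= M n /\ Cmod (u'' n z) <= M n /\
     is_derive (u n) z (u' n z) /\ is_derive (u' n) z (u'' n z)) ->
  forall z, D z ->
    is_derive (fun y => CSeries (fun n => u n y)) z (CSeries (fun n => u' n z)) /\
    continuous (fun y => CSeries (fun n => u' n y)) z.
Proof.
intros Hcv Hop HM H z Hz.
assert (Hsu : forall y, D y -> Csummable (fun n => u n y)).
{ intros y Hy; apply (Csummable_le _ M); [intros n; apply H, Hy|exact HM]. }
assert (Hsu' : forall y, D y -> Csummable (fun n => u' n y)).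
{ intros y Hy; apply (Csummable_le _ M); [intros n; apply (H n y Hy)|exact HM]. }
assert (L1 : forall n a b, D a -> D b ->
  Cmod (u' n b - u' n a) <= 2 * M n * Cmod (b - a)).
{ intros n a b Ha Hb; apply C_mean_value_bound with (f' := u'' n).
  intros t Ht; pose proof (H n _ (Hcv a b t Ha Hb Ht)); tauto. }
assert (HM0 : forall n, 0 <= M n).
{ intros n; eapply Rle_trans; [apply Cmod_ge_0|apply (H n z Hz)]. }
(* The mean value bound for w |-> u w - u'(z) w, whose derivative u'(w) - u'(z) is controlled by
   [L1]. Each of the two uses contributes a factor 2, whence the 4. *)
assert (L2 : forall n b, D b ->
  Cmod (u n b - u n z - (b - z) * u' n z) <= M n * (4 * Cmod (b - z) * Cmod (b - z))).
{ intros n b Hb.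
  replace (u n b - u n z - (b - z) * u' n z)%C
    with ((u n b - u' n z * b) - (u n z - u' n z * z))%C by ring.
  replace (M n * (4 * Cmod (b - z) * Cmod (b - z)))
    with (2 * (2 * M n * Cmod (b - z)) * Cmod (b - z)) by ring.
  apply C_mean_value_bound with
    (f := fun w => (u n w - u' n z * w)%C) (f' := fun w => (u' n w - u' n z)%C).
  intros t Ht; pose proof (Hcv z b t Hz Hb Ht) as Hw.
  set (w := (z + t * (b - z))%C) in *; split.
  - apply (is_derive_C_eq _ _ (u' n w - u' n z * 1)%C); [|ring].
    apply is_derive_C_minus; [apply (H n w Hw)|].
    apply is_derive_C_scal, is_derive_C_id.
  - eapply Rle_trans; [now apply L1|].
    apply Rmult_le_compat_l; [pose proof (HM0 n); lra|].
    unfold w; replace (z + t * (b - z) - z)%C with (RtoC t * (b - z))%C by ring.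
    rewrite Cmod_mult, Cmod_R, Rabs_pos_eq by lra.
    pose proof (Cmod_ge_0 (b - z)); nra. }
set (S := Series M).
assert (HS : 0 <= S).
{ unfold S; rewrite <- (Rmult_0_l (Series (fun _ => 0))), <- Series_scal_l.
  apply Series_le; [intros n; rewrite Rmult_0_l; split; [apply Rle_refl|apply HM0]|exact HM]. }
destruct (Hop z Hz) as [d0 Hd0]; pose proof (cond_pos d0).
split.
- apply is_derive_C_iff; intros eps; pose proof (cond_pos eps).
  (* The remainders add up to at most 2 * 4 S |y - z|^2; the 1 avoids a division by zero when S =
     0. *)
  assert (Hd : 0 < Rmin d0 (eps / (8 * S + 1))).
  { apply Rmin_pos; [lra|apply Rdiv_lt_0_compat; lra]. }
  exists (mkposreal _ Hd); intros y Hy; simpl in Hy.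
  pose proof (Hd0 y (Rlt_le_trans _ _ _ Hy (Rmin_l _ _))) as Hy1.
  pose proof (Rlt_le_trans _ _ _ Hy (Rmin_r _ _)) as Hy2.
  rewrite (Cmult_comm (CSeries _)), <- CSeries_scal, <- !CSeries_minus
    by auto using Csummable_minus, Csummable_scal.
  eapply Rle_trans.
  { apply Cmod_CSeries_le with (M := fun n => M n * (4 * Cmod (y - z) * Cmod (y - z))).
    - intros n; now apply L2.
    - now apply ex_series_scal_r. }
  rewrite Series_scal_r; fold S.
  apply Rlt_div_r in Hy2; [|lra].
  pose proof (Cmod_ge_0 (y - z)); nra.
- apply continuous_C_iff; intros eps; pose proof (cond_pos eps).
  assert (Hd : 0 < Rmin d0 (eps / (4 * S + 1))).
  { apply Rmin_pos; [lra|apply Rdiv_lt_0_compat; lra]. }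
  exists (mkposreal _ Hd); intros y Hy; simpl in Hy.
  pose proof (Hd0 y (Rlt_le_trans _ _ _ Hy (Rmin_l _ _))) as Hy1.
  pose proof (Rlt_le_trans _ _ _ Hy (Rmin_r _ _)) as Hy2.
  rewrite <- CSeries_minus by auto.
  eapply Rle_lt_trans.
  { apply Cmod_CSeries_le with (M := fun n => M n * (2 * Cmod (y - z))).
    - intros n; eapply Rle_trans; [now apply L1|right; ring].
    - now apply ex_series_scal_r. }
  rewrite Series_scal_r; fold S.
  apply Rlt_div_r in Hy2; [|lra].
  pose proof (Cmod_ge_0 (y - z)); nra.
Qed.

(** Two differentiations of log (1 - q^n) in z bring down n^2, so this is the majorant required. The
    ratio of consecutive terms tends to r. *)
Lemma ex_series_square_geom (r : R) : 0 < r < 1 ->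
  ex_series (fun n => INR (S n) ^ 2 * r ^ S n).
Proof.
intros Hr.
assert (Hpos : forall n, 0 < INR (S n) ^ 2 * r ^ S n).
{ intros n; apply Rmult_lt_0_compat; apply pow_lt; [apply lt_0_INR; lia|lra]. }
apply ex_series_ext with (fun n => Rabs (INR (S n) ^ 2 * r ^ S n)).
{ intros n; apply Rabs_pos_eq, Rlt_le, Hpos. }
apply ex_series_DAlembert with r; [lra| |].
- intros n; apply Rgt_not_eq, Hpos.
- apply is_lim_seq_ext with (fun n => (1 + / INR (S n)) * (1 + / INR (S n)) * r).
  + intros n; rewrite Rabs_pos_eq by (apply Rlt_le, Rdiv_lt_0_compat; apply Hpos).
    assert (0 < INR (S n)) by (apply lt_0_INR; lia).
    assert (0 < r ^ S n) by (apply pow_lt; lra).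
    rewrite (S_INR (S n)); change (r ^ S (S n)) with (r * r ^ S n).
    set (x := INR (S n)) in *; set (y := r ^ S n) in *; field; lra.
  + assert (Hl : is_lim_seq (fun n => 1 + / INR (S n)) (1 + 0)).
    { apply is_lim_seq_plus'; [apply is_lim_seq_const|].
      apply (is_lim_seq_incr_1 (fun n => / INR n)).
      replace (Finite 0) with (Rbar_inv p_infty) by reflexivity.
      apply is_lim_seq_inv; [apply is_lim_seq_INR|discriminate]. }
    replace (Finite r) with (Finite ((1 + 0) * (1 + 0) * r)) by (f_equal; ring).
    apply is_lim_seq_mult'; [now apply is_lim_seq_mult'|apply is_lim_seq_const].
Qed.

(** * A holomorphic logarithm of Delta *)

Lemma Re_one_minus_pos (q : C) : Cmod q < 1 -> 0 < Re (1 - q).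
Proof.
intros Hq; pose proof (re_le_Cmod q) as H; apply Rabs_le_between in H.
destruct q; simpl in *; lra.
Qed.

Lemma Cmod_one_minus_ge (q : C) : 1 - Cmod q <= Cmod (1 - q).
Proof.
assert (1 <= Cmod (1 - q) + Cmod q); [|lra].
rewrite <- Cmod_1 at 1; replace (RtoC 1) with (1 - q + q)%C at 1 by ring.
apply Cmod_triangle.
Qed.

(** The mean value bound between 1 and 1 - q: on that segment the derivative 1 / z of [Clog] has
    modulus at most 1 / (1 - r). *)
Lemma Cmod_Clog_one_minus_le (q : C) (r : R) : Cmod q <= r -> r < 1 ->
  Cmod (Clog (1 - q)) <= 2 * / (1 - r) * Cmod q.
Proof.
intros Hq Hr.
replace (Clog (1 - q)) with (Clog (1 - q) - Clog 1)%C by (rewrite Clog_1; ring).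
replace (Cmod q) with (Cmod (1 - q - 1)) by (rewrite <- Cmod_opp; f_equal; ring).
apply C_mean_value_bound with (f' := Cinv); intros t Ht.
replace (1 + t * (1 - q - 1))%C with (1 - t * q)%C by ring.
pose proof (Cmod_ge_0 q).
assert (Hm : Cmod (t * q) <= r).
{ rewrite Cmod_mult, Cmod_R, Rabs_pos_eq by lra; nra. }
pose proof (Cmod_one_minus_ge (t * q)).
split.
- apply is_derive_Clog, Re_one_minus_pos; lra.
- rewrite Cmod_inv by (apply Cmod_gt_0; lra).
  apply Rinv_le_contravar; lra.
Qed.

(** The index is [S N] because [sum_n] up to N has N + 1 terms. *)
Lemma Delta_prod_Cexp (q : C) (N : nat) : Cmod q < 1 ->
  Delta_prod q (S N) =
  Cexp (24 * (sum_n (fun n => Re (Clog (1 - q ^ S n))) N,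
              sum_n (fun n => Im (Clog (1 - q ^ S n))) N)).
Proof.
intros Hq.
assert (Hpos : forall n, 0 < Re (1 - q ^ S n)).
{ intros n; apply Re_one_minus_pos; rewrite Cmod_pow.
  apply pow_lt_1_compat; [split; [apply Cmod_ge_0|exact Hq]|lia]. }
assert (H24 : forall z, 0 < Re z -> Cexp (24 * Clog z) = (z ^ 24)%C).
{ intros z Hz; replace (RtoC 24) with (RtoC (INR 24)) by (f_equal; simpl; ring).
  now rewrite Cexp_mult_INR, Cexp_Clog. }
induction N as [|N IH].
- rewrite !sum_O.
  change (Re (Clog (1 - q ^ 1)), Im (Clog (1 - q ^ 1))) with (Clog (1 - q ^ 1)).
  rewrite H24 by apply Hpos.
  change (Delta_prod q 1) with (1 * (1 - q ^ 1) ^ 24)%C; ring.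
- rewrite !sum_Sn.
  change (Delta_prod q (S (S N))) with (Delta_prod q (S N) * (1 - q ^ S (S N)) ^ 24)%C.
  rewrite IH, <- (H24 _ (Hpos (S N))), <- Cexp_plus; f_equal.
  unfold plus; simpl.
  apply injective_projections; simpl; ring.
Qed.

(** Continuity of exp, cos and sin carries the limit inside. It also shows that the limits in
    [Delta_infprod] exist and are finite, so that [real (Lim_seq _)] is the true limit and no
    default value. *)
Lemma Delta_infprod_Cexp (q : C) : Cmod q < 1 ->
  Csummable (fun n => Clog (1 - q ^ S n)) ->
  Delta_infprod q = Cexp (24 * CSeries (fun n => Clog (1 - q ^ S n))%C).
Proof.
intros Hq Hs.
pose proof (Series_correct _ (Csummable_Re _ Hs)) as Hr.
pose proof (Series_correct _ (Csummable_Im _ Hs)) as Hi.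
set (a := sum_n (fun n => Re (Clog (1 - q ^ S n)))) in *.
set (b := sum_n (fun n => Im (Clog (1 - q ^ S n)))) in *.
assert (H24 : forall (c : nat -> R) (l : R) (f : R -> R),
  continuity f -> is_lim_seq c l -> is_lim_seq (fun N => f (24 * c N)) (f (24 * l))).
{ intros c l f Hf Hc; apply is_lim_seq_continuous; [apply Hf|].
  now apply (is_lim_seq_scal_l c 24 l). }
assert (HE : forall x y : R,
  Cexp (24 * (x, y)) = (exp (24 * x) * cos (24 * y), exp (24 * x) * sin (24 * y))).
{ intros x y; unfold Cexp; simpl.
  replace (24 * x - 0 * y) with (24 * x) by ring.
  replace (24 * y + 0 * x) with (24 * y) by ring; reflexivity. }
pose proof (derivable_continuous _ derivable_exp) as Hexp.
unfold Delta_infprod, CSeries; rewrite HE; f_equal.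
- rewrite (is_lim_seq_unique _
    (exp (24 * Series (fun n => Re (Clog (1 - q ^ S n)))) *
     cos (24 * Series (fun n => Im (Clog (1 - q ^ S n)))))); [reflexivity|].
  (* Drops the empty product, to which [Delta_prod_Cexp] does not apply. *)
  apply is_lim_seq_incr_1.
  apply is_lim_seq_ext with (fun N => exp (24 * a N) * cos (24 * b N)).
  + intros N; rewrite Delta_prod_Cexp, HE by exact Hq; reflexivity.
  + apply is_lim_seq_mult'; apply H24; auto using continuity_cos.
- rewrite (is_lim_seq_unique _
    (exp (24 * Series (fun n => Re (Clog (1 - q ^ S n)))) *
     sin (24 * Series (fun n => Im (Clog (1 - q ^ S n)))))); [reflexivity|].
  apply is_lim_seq_incr_1.
  apply is_lim_seq_ext with (fun N => exp (24 * a N) * sin (24 * b N)).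
  + intros N; rewrite Delta_prod_Cexp, HE by exact Hq; reflexivity.
  + apply is_lim_seq_mult'; apply H24; auto using continuity_sin.
Qed.

Definition nome_exponent (n : nat) : C := (INR (S n) * (2 * PI * Ci))%C.

Lemma nome_pow (n : nat) (z : C) : (nome z ^ S n)%C = Cexp (nome_exponent n * z).
Proof.
unfold nome, nome_exponent; rewrite <- Cexp_mult_INR; f_equal; ring.
Qed.

Lemma Cmod_nome (z : C) : Cmod (nome z) = exp (- (2 * PI * Im z)).
Proof.
unfold nome; rewrite Cmod_Cexp; f_equal; destruct z; simpl; ring.
Qed.

Lemma Cmod_nome_lt_1 (z : C) : upper_half_plane z -> Cmod (nome z) < 1.
Proof.
unfold upper_half_plane; intros Hz; rewrite Cmod_nome, <- exp_0.
apply exp_increasing; pose proof PI_RGT_0; nra.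
Qed.

Definition log_factor (n : nat) (z : C) : C := Clog (1 - nome z ^ S n).

Definition log_factor' (n : nat) (z : C) : C :=
  (- nome_exponent n * (nome z ^ S n / (1 - nome z ^ S n)))%C.

Definition log_factor'' (n : nat) (z : C) : C :=
  (- (nome_exponent n * nome_exponent n) *
   (nome z ^ S n / ((1 - nome z ^ S n) * (1 - nome z ^ S n))))%C.

Lemma is_derive_nome_pow (n : nat) (z : C) :
  is_derive (fun y => nome y ^ S n)%C z (nome_exponent n * nome z ^ S n)%C.
Proof.
apply is_derive_ext with (fun y => Cexp (nome_exponent n * y)).
{ intros y; symmetry; apply nome_pow. }
rewrite nome_pow.
apply (is_derive_C_eq _ _ (Cexp (nome_exponent n * z) * (nome_exponent n * 1))%C); [|ring].
apply (is_derive_C_comp Cexp (fun y => nome_exponent n * y)%C).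
- apply is_derive_Cexp.
- apply is_derive_C_scal, is_derive_C_id.
Qed.

Lemma is_derive_log_factor (n : nat) (z : C) : upper_half_plane z ->
  is_derive (log_factor n) z (log_factor' n z) /\
  is_derive (log_factor' n) z (log_factor'' n z).
Proof.
intros Hz; unfold log_factor, log_factor', log_factor''.
assert (Hq : Cmod (nome z ^ S n) < 1).
{ rewrite Cmod_pow; apply pow_lt_1_compat; [|lia].
  split; [apply Cmod_ge_0|now apply Cmod_nome_lt_1]. }
pose proof (Re_one_minus_pos _ Hq) as Hp.
assert (H0 : (1 - nome z ^ S n)%C <> 0) by (intros E; rewrite E in Hp; simpl in Hp; lra).
pose proof (is_derive_nome_pow n z) as D.
set (k := nome_exponent n) in *.
assert (D1 : is_derive (fun y => 1 - nome y ^ S n)%C z (0 - k * nome z ^ S n)%C).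
{ apply is_derive_C_minus; [apply is_derive_C_const|exact D]. }
split.
- eapply is_derive_C_eq.
  + exact (is_derive_C_comp Clog _ z _ _ (is_derive_Clog _ Hp) D1).
  + cbv beta; now field.
- eapply is_derive_C_eq.
  + apply is_derive_C_scal.
    exact (is_derive_C_div _ _ z _ _ D D1 H0).
  + cbv beta; now field.
Qed.

(** For Im z > d the modulus of the nome stays below r = exp (- 2 PI d) < 1, and geometric decay
    absorbs the polynomial factors of the derivatives. *)
Lemma log_factor_bounds (d : R) : 0 < d -> exists M : nat -> R,
  ex_series M /\ forall n z, d < Im z ->
    Cmod (log_factor n z) <= M n /\ Cmod (log_factor' n z) <= M n /\
    Cmod (log_factor'' n z) <= M n.
Proof.
intros Hd; set (r := exp (- (2 * PI * d))).
pose proof PI_RGT_0 as HPI; pose proof PI2_1 as HPI1.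
assert (Hr : 0 < r < 1).
{ split; [apply exp_pos|]; rewrite <- exp_0; apply exp_increasing; nra. }
(* With x = n + 1, each differentiation costs at most a factor A x. Since A and x are at least 1,
   the bound for the second derivative serves for all three. *)
set (A := 2 * PI / (1 - r)).
exists (fun n => A * A * (INR (S n) ^ 2 * r ^ S n)); split.
{ exact (ex_series_scal (A * A) _ (ex_series_square_geom r Hr)). }
intros n z Hz.
set (x := INR (S n)); set (y := r ^ S n).
assert (Hx : 1 <= x) by (unfold x; rewrite S_INR; pose proof (pos_INR n); lra).
assert (Hq : Cmod (nome z ^ S n) <= y).
{ rewrite Cmod_pow, Cmod_nome; apply pow_incr; split; [apply Rlt_le, exp_pos|].
  apply Rlt_le, exp_increasing; nra. }
assert (Hy : 0 < y <= r).
{ unfold y; split; [apply pow_lt, Hr|]; simpl.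
  assert (r ^ n <= 1) by (rewrite <- (pow1 n); apply pow_incr; lra).
  pose proof (pow_lt r n (proj1 Hr)); nra. }
assert (Hk : Cmod (nome_exponent n) = 2 * PI * x).
{ unfold nome_exponent; rewrite !Cmod_mult, Cmod_Ci, !Cmod_R, !Rabs_pos_eq; fold x; lra. }
pose proof (Cmod_one_minus_ge (nome z ^ S n)) as H1.
assert (H2 : 1 - r <= Cmod (1 - nome z ^ S n)) by lra.
assert (H0 : (1 - nome z ^ S n)%C <> 0) by (apply Cmod_gt_0; lra).
set (w := Cmod (1 - nome z ^ S n)) in *.
set (e := Cmod (nome z ^ S n)) in *.
assert (He : 0 <= e) by apply Cmod_ge_0.
assert (HA1 : 2 * / (1 - r) <= A).
{ unfold A; apply Rmult_le_compat_r; [apply Rlt_le, Rinv_0_lt_compat|]; lra. }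
assert (HA2 : 2 <= A).
{ assert (1 <= / (1 - r)) by (rewrite <- Rinv_1 at 1; apply Rinv_le_contravar; lra).
  unfold A, Rdiv; nra. }
assert (HA3 : 2 * PI / w <= A).
{ unfold A; apply Rmult_le_compat_l; [lra|]; apply Rinv_le_contravar; lra. }
assert (HA4 : 0 < 2 * PI / w) by (apply Rdiv_lt_0_compat; lra).
simpl pow; rewrite Rmult_1_r.
assert (Hxx : x <= x * x) by nra.
assert (Hxy : x * y <= x * x * y) by (apply Rmult_le_compat_r; lra).
assert (HAA : A <= A * A) by nra.
assert (Hyx : y <= x * y) by nra.
repeat split.
- eapply Rle_trans; [apply (Cmod_Clog_one_minus_le _ r); fold e; lra|]; fold e.
  apply Rle_trans with (A * y); [|apply Rmult_le_compat; lra].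
  apply Rmult_le_compat; try lra.
  apply Rlt_le, Rmult_lt_0_compat; [lra|apply Rinv_0_lt_compat; lra].
- unfold log_factor'; rewrite Cmod_mult, Cmod_opp, Cmod_div, Hk by exact H0; fold w e.
  replace (2 * PI * x * (e / w)) with (2 * PI / w * (x * e)) by (field; lra).
  apply Rle_trans with (A * (x * y)); [|apply Rmult_le_compat; nra].
  apply Rmult_le_compat; nra.
- unfold log_factor''.
  rewrite Cmod_mult, Cmod_opp, Cmod_div, !Cmod_mult, Hk by (now apply Cmult_neq_0).
  fold w e.
  replace (2 * PI * x * (2 * PI * x) * (e / (w * w)))
    with (2 * PI / w * (2 * PI / w) * (x * x * e)) by (field; lra).
  apply Rmult_le_compat; nra.
Qed.

(** * Continuously differentiable functions on the upper half-plane *)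

Lemma continuous_C_AbsRing {T : UniformSpace} (f : T -> C) (x : T) :
  continuous (U := AbsRing_UniformSpace C_AbsRing) f x <-> continuous f x.
Proof.
split; intros H P HP; apply H; apply (locally_C (f x)); exact HP.
Qed.

Lemma continuous_C_mult {T : UniformSpace} (f g : T -> C) (x : T) :
  continuous f x -> continuous g x -> continuous (fun y => f y * g y)%C x.
Proof.
intros Hf Hg; apply continuous_C_AbsRing.
apply (continuous_mult (K := C_AbsRing)); now apply continuous_C_AbsRing.
Qed.

Lemma continuous_C_plus {T : UniformSpace} (f g : T -> C) (x : T) :
  continuous f x -> continuous g x -> continuous (fun y => f y + g y)%C x.
Proof. apply (continuous_plus (V := C_NormedModule)). Qed.

Lemma continuous_C_minus {T : UniformSpace} (f g : T -> C) (x : T) :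
  continuous f x -> continuous g x -> continuous (fun y => f y - g y)%C x.
Proof. apply (continuous_minus (V := C_NormedModule)). Qed.

Lemma continuous_C_div {T : UniformSpace} (f g : T -> C) (x : T) :
  continuous f x -> continuous g x -> g x <> 0 ->
  continuous (fun y => f y / g y)%C x.
Proof.
intros Hf Hg H0; apply continuous_C_mult; [exact Hf|].
apply (continuous_comp g Cinv); [exact Hg|].
eapply is_derive_C_continuous, is_derive_C_inv, H0.
Qed.

(* The continuity of [f'] is carried along because it is needed to integrate [f']
   over segments. *)
Definition C1_uhp (f f' : C -> C) : Prop :=
  forall z, upper_half_plane z -> is_derive f z (f' z) /\ continuous f' z.

Lemma C1_uhp_plus (f f' g g' : C -> C) : C1_uhp f f' -> C1_uhp g g' ->
  C1_uhp (fun z => f z + g z)%C (fun z => f' z + g' z)%C.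
Proof.
intros Hf Hg z Hz; destruct (Hf z Hz), (Hg z Hz); split.
- now apply is_derive_C_plus.
- now apply continuous_C_plus.
Qed.

Lemma C1_uhp_minus (f f' g g' : C -> C) : C1_uhp f f' -> C1_uhp g g' ->
  C1_uhp (fun z => f z - g z)%C (fun z => f' z - g' z)%C.
Proof.
intros Hf Hg z Hz; destruct (Hf z Hz), (Hg z Hz); split.
- now apply is_derive_C_minus.
- now apply continuous_C_minus.
Qed.

Lemma C1_uhp_const (c : C) : C1_uhp (fun _ => c) (fun _ => RtoC 0).
Proof. intros z Hz; split; [apply is_derive_C_const|apply continuous_const]. Qed.

Lemma C1_uhp_id : C1_uhp (fun z => z) (fun _ => RtoC 1).
Proof. intros z Hz; split; [apply is_derive_C_id|apply continuous_const]. Qed.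

Lemma C1_uhp_scal (c : C) (f f' : C -> C) : C1_uhp f f' ->
  C1_uhp (fun z => c * f z)%C (fun z => c * f' z)%C.
Proof.
intros Hf z Hz; destruct (Hf z Hz); split.
- now apply is_derive_C_scal.
- apply continuous_C_mult; [apply continuous_const|assumption].
Qed.

Lemma C1_uhp_continuous (f f' : C -> C) (z : C) :
  C1_uhp f f' -> upper_half_plane z -> continuous f z.
Proof. intros Hf Hz; eapply is_derive_C_continuous, Hf, Hz. Qed.

Lemma C1_uhp_div (f f' g g' : C -> C) : C1_uhp f f' -> C1_uhp g g' ->
  (forall z, upper_half_plane z -> g z <> 0) ->
  C1_uhp (fun z => f z / g z)%C (fun z => (f' z * g z - f z * g' z) / (g z * g z))%C.
Proof.
intros Hf Hg H0 z Hz.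
pose proof (C1_uhp_continuous _ _ z Hf Hz).
pose proof (C1_uhp_continuous _ _ z Hg Hz).
destruct (Hf z Hz), (Hg z Hz); pose proof (H0 z Hz); split.
- now apply is_derive_C_div.
- apply continuous_C_div.
  + apply continuous_C_minus; now apply continuous_C_mult.
  + now apply continuous_C_mult.
  + now apply Cmult_neq_0.
Qed.

Lemma C1_uhp_comp (f f' g g' : C -> C) : C1_uhp f f' -> C1_uhp g g' ->
  (forall z, upper_half_plane z -> upper_half_plane (g z)) ->
  C1_uhp (fun z => f (g z)) (fun z => f' (g z) * g' z)%C.
Proof.
intros Hf Hg H0 z Hz.
pose proof (C1_uhp_continuous _ _ z Hg Hz).
destruct (Hf _ (H0 z Hz)), (Hg z Hz); split.
- now apply is_derive_C_comp.
- apply continuous_C_mult; [now apply continuous_comp|assumption].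
Qed.

Lemma C1_uhp_Clog (g g' : C -> C) : C1_uhp g g' ->
  (forall z, upper_half_plane z -> 0 < Re (g z)) ->
  C1_uhp (fun z => Clog (g z)) (fun z => g' z / g z)%C.
Proof.
intros Hg H0 z Hz.
pose proof (C1_uhp_continuous _ _ z Hg Hz).
pose proof (H0 z Hz) as Hp; destruct (Hg z Hz); split.
- eapply is_derive_C_eq.
  + apply is_derive_C_comp; [now apply is_derive_Clog|eassumption].
  + apply Cmult_comm.
- apply continuous_C_div; try assumption.
  intros E; rewrite E in Hp; simpl in Hp; lra.
Qed.

(** * Differentiability of the logarithm of Delta *)

Lemma Im_segment_gt (c : R) (a b : C) (t : R) : c < Im a -> c < Im b ->
  0 <= t <= 1 -> c < Im (a + RtoC t * (b - a))%C.
Proof.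
destruct a as [a1 a2], b as [b1 b2]; simpl; intros Ha Hb Ht.
assert (0 <= t * (b2 - c)) by (apply Rmult_le_pos; lra).
assert (0 <= (1 - t) * (a2 - c)) by (apply Rmult_le_pos; lra).
(* One of the weights t and 1 - t is at least 1 / 2, which makes the inequality strict. *)
destruct (Rle_lt_dec t (1 / 2)); nra.
Qed.

(** The majorants degenerate near the real axis, so the half-plane of termwise differentiation
    depends on z: it is Im y > Im z / 2, convex and open. *)
Lemma C1_uhp_log_factor_series :
  C1_uhp (fun z => CSeries (fun n => log_factor n z))
         (fun z => CSeries (fun n => log_factor' n z)).
Proof.
intros z Hz; unfold upper_half_plane in Hz.
destruct (log_factor_bounds (Im z / 2) ltac:(lra)) as [M [HM Hb]].
apply (is_derive_CSeries (fun y => Im z / 2 < Im y) log_factor log_factor' log_factor'' M).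
- intros a b t; apply Im_segment_gt.
- intros y Hy.
  assert (Hd : 0 < Im y - Im z / 2) by lra.
  exists (mkposreal _ Hd); intros x Hx; simpl in Hx.
  pose proof (im_le_Cmod (x - y)) as H; apply Rabs_le_between in H.
  destruct x, y; simpl in *; lra.
- exact HM.
- intros n y Hy; destruct (Hb n y Hy) as [B0 [B1 B2]].
  destruct (is_derive_log_factor n y) as [D1 D2]; [unfold upper_half_plane; lra|].
  tauto.
- lra.
Qed.

Definition log_Delta (z : C) : C :=
  (12 * ln (2 * PI) + 2 * PI * Ci * z + 24 * CSeries (fun n => log_factor n z))%C.

(* [Delta] alone would be Stdlib's [R_sqrt.Delta]. *)
Lemma Cexp_log_Delta (z : C) : upper_half_plane z -> Cexp (log_Delta z) = Defs.Delta z.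
Proof.
intros Hz; unfold log_Delta, Defs.Delta.
rewrite !Cexp_plus, Delta_infprod_Cexp.
- f_equal; f_equal.
  replace (RtoC 12) with (RtoC (INR 12)) by (f_equal; simpl; ring).
  rewrite Cexp_mult_INR; f_equal.
  pose proof PI_RGT_0.
  unfold Cexp; simpl; rewrite cos_0, sin_0, exp_ln by lra.
  apply injective_projections; simpl; ring.
- now apply Cmod_nome_lt_1.
- unfold upper_half_plane in Hz.
  destruct (log_factor_bounds (Im z / 2) ltac:(lra)) as [M [HM Hb]].
  apply Csummable_le with M; [|exact HM].
  intros n; apply Hb; lra.
Qed.

Lemma C1_uhp_log_Delta : exists f', C1_uhp log_Delta f'.
Proof.
eexists; apply C1_uhp_plus; [apply C1_uhp_plus|].
- apply C1_uhp_const.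
- apply C1_uhp_scal, C1_uhp_id.
- apply C1_uhp_scal, C1_uhp_log_factor_series.
Qed.

(** * Integration along segments *)

Lemma continuous_RtoC (t : R) : continuous RtoC t.
Proof.
intros P [e HP]; exists e; intros y Hy; apply HP; split; [exact Hy|apply ball_center].
Qed.

Lemma continuous_segment (a b : C) (t : R) :
  continuous (fun s : R => a + RtoC s * (b - a))%C t.
Proof.
apply continuous_C_plus; [apply continuous_const|].
apply continuous_C_mult; [apply continuous_RtoC|apply continuous_const].
Qed.

Lemma segment_int_C1 (f f' : C -> C) (a b : C) : C1_uhp f f' ->
  upper_half_plane a -> upper_half_plane b ->
  segment_int f' a b = (f b - f a)%C.
Proof.
intros Hf Ha Hb; unfold segment_int; apply (is_RInt_unique (V := C_R_CompleteNormedModule)).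
pose proof (is_RInt_derive (V := C_R_CompleteNormedModule)
  (fun t : R => f (a + RtoC t * (b - a))%C)
  (fun t : R => (f' (a + RtoC t * (b - a)) * (b - a))%C) 0 1) as H.
replace (f b - f a)%C with (minus (G := C_R_CompleteNormedModule)
  (f (a + RtoC 1 * (b - a))%C) (f (a + RtoC 0 * (b - a))%C)).
- apply H; clear H; intros t Ht; rewrite Rmin_left, Rmax_right in Ht by lra;
    pose proof (Im_segment_gt 0 a b t Ha Hb Ht) as Hu; destruct (Hf _ Hu).
  + now apply is_derive_along_line.
  + apply continuous_C_mult; [|apply continuous_const].
    apply (continuous_comp (fun t : R => a + RtoC t * (b - a))%C f').
    * apply continuous_segment.
    * assumption.
- replace (a + RtoC 1 * (b - a))%C with b by ring.
  replace (a + RtoC 0 * (b - a))%C with a by ring.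
  reflexivity.
Qed.

(** * The action on the unit disk *)

Lemma Cmod_sqr (z : C) : Cmod z * Cmod z = Re z * Re z + Im z * Im z.
Proof. pose proof (Cmod2_alt z) as H; simpl in H; lra. Qed.

Lemma Cmod_le_sqr (z w : C) :
  Re z * Re z + Im z * Im z <= Re w * Re w + Im w * Im w -> Cmod z <= Cmod w.
Proof.
rewrite <- !Cmod_sqr; intros H.
pose proof (Cmod_ge_0 z); pose proof (Cmod_ge_0 w); nra.
Qed.

(* The Cayley transform conjugates [g] to [[conj p, conj r], [r, p]], and
   [|p|^2 - |r|^2 = det2 g]. *)
Definition disk_p (g : mat2) : C := ((m11 g + m22 g) / 2, (m21 g - m12 g) / 2).
Definition disk_r (g : mat2) : C := ((m11 g - m22 g) / 2, (m21 g + m12 g) / 2).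

Definition disk_automorphy (g : mat2) (w : C) : C := (disk_p g + disk_r g * w)%C.

Definition disk_mobius (g : mat2) (w : C) : C :=
  ((Cconj (disk_p g) * w + Cconj (disk_r g)) / disk_automorphy g w)%C.

Definition cayley (z : C) : C := ((z - Ci) / (z + Ci))%C.

Lemma Cmod_disk_r_lt (g : mat2) : det2 g = 1 -> Cmod (disk_r g) < Cmod (disk_p g).
Proof.
intros Hg; pose proof (Cmod_sqr (disk_p g)) as Hp; pose proof (Cmod_sqr (disk_r g)) as Hr.
pose proof (Cmod_ge_0 (disk_p g)); pose proof (Cmod_ge_0 (disk_r g)).
unfold det2 in Hg; simpl in Hp, Hr.
apply Rsqr_incrst_0; try assumption.
unfold Rsqr; rewrite Hp, Hr; nra.
Qed.

Lemma disk_p_neq_0 (g : mat2) : det2 g = 1 -> disk_p g <> 0.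
Proof.
intros Hg; apply Cmod_gt_0.
eapply Rle_lt_trans; [apply Cmod_ge_0|now apply Cmod_disk_r_lt].
Qed.

Lemma Re_disk_ratio_pos (g : mat2) (w : C) : det2 g = 1 -> Cmod w <= 1 ->
  0 < Re (1 + disk_r g / disk_p g * w).
Proof.
intros Hg Hw; pose proof (disk_p_neq_0 g Hg) as H0.
replace (1 + disk_r g / disk_p g * w)%C with (1 - - (disk_r g / disk_p g * w))%C by ring.
apply Re_one_minus_pos.
rewrite Cmod_opp, Cmod_mult, Cmod_div by exact H0.
pose proof (Cmod_disk_r_lt g Hg) as Hlt; pose proof (Cmod_ge_0 (disk_r g)) as Hr.
apply Rle_lt_trans with (Cmod (disk_r g) / Cmod (disk_p g) * 1).
- apply Rmult_le_compat_l; [|exact Hw].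
  apply Rmult_le_pos; [exact Hr|]; apply Rlt_le, Rinv_0_lt_compat; lra.
- rewrite Rmult_1_r; apply Rlt_div_l; lra.
Qed.

Lemma disk_automorphy_ratio (g : mat2) (w : C) : det2 g = 1 ->
  disk_automorphy g w = (disk_p g * (1 + disk_r g / disk_p g * w))%C.
Proof.
intros Hg; pose proof (disk_p_neq_0 g Hg); unfold disk_automorphy; now field.
Qed.

Lemma disk_automorphy_neq_0 (g : mat2) (w : C) : det2 g = 1 -> Cmod w <= 1 ->
  disk_automorphy g w <> 0.
Proof.
intros Hg Hw; rewrite disk_automorphy_ratio by exact Hg.
apply Cmult_neq_0; [now apply disk_p_neq_0|].
intros E; pose proof (Re_disk_ratio_pos g w Hg Hw) as H; rewrite E in H; simpl in H; lra.
Qed.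

(** The squared moduli of denominator and numerator differ by [det2 g] times 1 - |w|^2. *)
Lemma Cmod_disk_mobius_le (g : mat2) (w : C) : det2 g = 1 -> Cmod w <= 1 ->
  Cmod (disk_mobius g w) <= 1.
Proof.
intros Hg Hw; pose proof (disk_automorphy_neq_0 g w Hg Hw) as H0.
unfold disk_mobius; rewrite Cmod_div by exact H0.
apply Cmod_gt_0 in H0; apply Rle_div_l; [exact H0|].
rewrite Rmult_1_l; apply Cmod_le_sqr.
pose proof (Cmod_sqr w) as Hs; pose proof (Cmod_ge_0 w).
unfold disk_automorphy, disk_p, disk_r.
destruct g as [a b c d], w as [x y]; unfold det2 in Hg; simpl in *.
assert (Hxy : 0 <= 1 - (x * x + y * y)) by nra.
apply Rminus_le_0.
match goal with |- 0 <= ?e =>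
  replace e with ((a * d - b * c) * (1 - (x * x + y * y))) by field end.
rewrite Hg; lra.
Qed.

Lemma disk_automorphy_mul (g h : mat2) (w : C) : disk_automorphy h w <> 0 ->
  disk_automorphy (mat2_mul g h) w =
  (disk_automorphy g (disk_mobius h w) * disk_automorphy h w)%C.
Proof.
intros H0; transitivity (disk_p g * disk_automorphy h w +
  disk_r g * (Cconj (disk_p h) * w + Cconj (disk_r h)))%C.
- destruct g, h, w; apply injective_projections; simpl; field.
- unfold disk_mobius; unfold disk_automorphy at 2; now field.
Qed.

Lemma disk_mobius_mul (g h : mat2) (w : C) : det2 g = 1 -> det2 h = 1 -> Cmod w <= 1 ->
  disk_mobius (mat2_mul g h) w = disk_mobius g (disk_mobius h w).
Proof.
intros Hg Hh Hw.
pose proof (disk_automorphy_neq_0 h w Hh Hw) as H0.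
pose proof (disk_automorphy_neq_0 g _ Hg (Cmod_disk_mobius_le h w Hh Hw)) as H1.
assert (E : (Cconj (disk_p (mat2_mul g h)) * w + Cconj (disk_r (mat2_mul g h)) =
  Cconj (disk_p g) * (Cconj (disk_p h) * w + Cconj (disk_r h)) +
  Cconj (disk_r g) * disk_automorphy h w)%C).
{ destruct g, h, w; apply injective_projections; simpl; field. }
unfold disk_mobius at 1; rewrite E, disk_automorphy_mul by exact H0.
unfold disk_mobius at 2; set (u := disk_mobius h w) in *.
replace (Cconj (disk_p h) * w + Cconj (disk_r h))%C with (u * disk_automorphy h w)%C
  by (unfold u, disk_mobius; now field).
now field.
Qed.

Lemma plus_Ci_neq_0 (z : C) : upper_half_plane z -> (z + Ci)%C <> 0.
Proof.
intros Hz E; apply (f_equal Im) in E; unfold upper_half_plane in Hz.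
destruct z; simpl in *; lra.
Qed.

Lemma Cmod_cayley_le (z : C) : upper_half_plane z -> Cmod (cayley z) <= 1.
Proof.
intros Hz; pose proof (plus_Ci_neq_0 z Hz) as H0; unfold upper_half_plane in Hz.
unfold cayley; rewrite Cmod_div by exact H0.
apply Cmod_gt_0 in H0; apply Rle_div_l; [exact H0|].
rewrite Rmult_1_l; apply Cmod_le_sqr; destruct z; simpl in *; nra.
Qed.

Lemma automorphy_neq_0 (g : mat2) (z : C) : det2 g = 1 -> upper_half_plane z ->
  automorphy g z <> 0.
Proof.
intros Hg Hz E; unfold upper_half_plane in Hz; unfold det2 in Hg.
destruct g as [a b c d], z as [x y].
pose proof (f_equal Re E) as Er; pose proof (f_equal Im E) as Ei; simpl in *.
assert (c = 0) by nra; assert (d = 0) by nra; subst; lra.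
Qed.

Lemma mobius_uhp (g : mat2) (z : C) : det2 g = 1 -> upper_half_plane z ->
  upper_half_plane (mobius g z).
Proof.
intros Hg Hz; pose proof (automorphy_neq_0 g z Hg Hz) as H0.
apply Cmod_gt_0 in H0; pose proof (Cmod_sqr (automorphy g z)) as Hs.
assert (Hp : 0 < Cmod (automorphy g z) * Cmod (automorphy g z)) by nra.
rewrite Hs in Hp; clear Hs H0.
unfold upper_half_plane, det2 in *; destruct g as [a b c d], z as [x y]; simpl in *.
match goal with |- 0 < ?e => replace e with
  ((a * d - b * c) * y / ((c * x - 0 * y + d) * (c * x - 0 * y + d) +
                          (c * y + 0 * x + 0) * (c * y + 0 * x + 0))) end.
- rewrite Hg; apply Rdiv_lt_0_compat; lra.
- field; nra.
Qed.

(** Let K be the Cayley matrix with rows (1, -i) and (1, i), and G the conjugate of g by K. This is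
    the second row of K g = G K applied to the vector (z, 1); the first row gives the identity [E]
    in [cayley_mobius]. *)
Lemma cayley_automorphy (g : mat2) (z : C) : det2 g = 1 -> upper_half_plane z ->
  (automorphy g z * (mobius g z + Ci) = (z + Ci) * disk_automorphy g (cayley z))%C.
Proof.
intros Hg Hz.
pose proof (automorphy_neq_0 g z Hg Hz); pose proof (plus_Ci_neq_0 z Hz).
transitivity (m11 g * z + m12 g + Ci * automorphy g z)%C.
- unfold mobius; now field.
- transitivity (disk_p g * (z + Ci) + disk_r g * (z - Ci))%C.
  + destruct g, z; apply injective_projections; simpl; field.
  + unfold disk_automorphy, cayley; now field.
Qed.

Lemma cayley_mobius (g : mat2) (z : C) : det2 g = 1 -> upper_half_plane z ->
  cayley (mobius g z) = disk_mobius g (cayley z).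
Proof.
intros Hg Hz.
pose proof (automorphy_neq_0 g z Hg Hz) as Hj; pose proof (plus_Ci_neq_0 z Hz) as Hi.
pose proof (plus_Ci_neq_0 _ (mobius_uhp g z Hg Hz)) as Hm.
pose proof (disk_automorphy_neq_0 g _ Hg (Cmod_cayley_le z Hz)) as Hd.
assert (E : (automorphy g z * (mobius g z - Ci) =
  (z + Ci) * (Cconj (disk_p g) * cayley z + Cconj (disk_r g)))%C).
{ transitivity (m11 g * z + m12 g - Ci * automorphy g z)%C.
  - unfold mobius; now field.
  - transitivity (Cconj (disk_p g) * (z - Ci) + Cconj (disk_r g) * (z + Ci))%C.
    + destruct g, z; apply injective_projections; simpl; field.
    + unfold cayley; now field. }
pose proof (cayley_automorphy g z Hg Hz) as E'.
unfold cayley at 1; unfold disk_mobius.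
transitivity ((automorphy g z * (mobius g z - Ci)) / (automorphy g z * (mobius g z + Ci)))%C.
- now field.
- rewrite E, E'; now field.
Qed.

Lemma mobius_mul (g h : mat2) (z : C) : det2 g = 1 -> det2 h = 1 -> upper_half_plane z ->
  mobius (mat2_mul g h) z = mobius g (mobius h z).
Proof.
intros Hg Hh Hz.
pose proof (automorphy_neq_0 h z Hh Hz) as H0.
pose proof (automorphy_neq_0 g _ Hg (mobius_uhp h z Hh Hz)) as H1.
assert (E : (automorphy (mat2_mul g h) z =
  automorphy g (mobius h z) * automorphy h z)%C).
{ transitivity (m21 g * (m11 h * z + m12 h) + m22 g * automorphy h z)%C.
  - destruct g, h, z; apply injective_projections; simpl; ring.
  - unfold mobius; unfold automorphy at 2; now field. }
unfold mobius at 1; rewrite E.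
replace (m11 (mat2_mul g h) * z + m12 (mat2_mul g h))%C
  with (m11 g * (m11 h * z + m12 h) + m12 g * automorphy h z)%C
  by (destruct g, h, z; apply injective_projections; simpl; ring).
unfold mobius at 2; set (u := mobius h z) in *.
replace (m11 h * z + m12 h)%C with (u * automorphy h z)%C
  by (unfold u, mobius; now field).
now field.
Qed.

(** * Lifts of the boundary action *)

(** An arbitrary logarithm. It is only applied to the constants [disk_p g], where another choice
    shifts the lift of g by an even integer. *)
Definition Cln (z : C) : C := epsilon (inhabits (RtoC 0)) (fun l => Cexp l = z).

Lemma Cexp_Cln (z : C) : z <> 0 -> Cexp (Cln z) = z.
Proof. intros Hz.
exact (epsilon_spec (inhabits (RtoC 0)) (fun l => Cexp l = z) (Cexp_surj z Hz)). Qed.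

Definition log_disk_automorphy (g : mat2) (w : C) : C :=
  (Cln (disk_p g) + Clog (1 + disk_r g / disk_p g * w))%C.

Lemma Cexp_log_disk_automorphy (g : mat2) (w : C) : det2 g = 1 -> Cmod w <= 1 ->
  Cexp (log_disk_automorphy g w) = disk_automorphy g w.
Proof.
intros Hg Hw; unfold log_disk_automorphy.
rewrite Cexp_plus, Cexp_Cln, Cexp_Clog, disk_automorphy_ratio; auto.
- now apply Re_disk_ratio_pos.
- now apply disk_p_neq_0.
Qed.

Lemma continuous_log_disk_automorphy (g : mat2) (w : C) : det2 g = 1 -> Cmod w <= 1 ->
  continuous (log_disk_automorphy g) w.
Proof.
intros Hg Hw; unfold log_disk_automorphy.
apply continuous_C_plus; [apply continuous_const|].
apply (continuous_comp (fun w => 1 + disk_r g / disk_p g * w)%C Clog).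
- apply continuous_C_plus; [apply continuous_const|].
  apply continuous_C_mult; [apply continuous_const|apply continuous_id].
- now apply continuous_Clog, Re_disk_ratio_pos.
Qed.

Lemma continuous_disk_mobius (g : mat2) (w : C) : det2 g = 1 -> Cmod w <= 1 ->
  continuous (disk_mobius g) w.
Proof.
intros Hg Hw; apply continuous_C_div.
- apply continuous_C_plus; [|apply continuous_const].
  apply continuous_C_mult; [apply continuous_const|apply continuous_id].
- apply continuous_C_plus; [apply continuous_const|].
  apply continuous_C_mult; [apply continuous_const|apply continuous_id].
- now apply disk_automorphy_neq_0.
Qed.

Lemma continuous_integer_valued (h : R -> R) :
  (forall t, 0 <= t <= 1 -> continuous h t) ->
  (forall t, 0 <= t <= 1 -> exists k : Z, h t = IZR k) -> h 0 = h 1.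
Proof.
assert (Hle : forall h : R -> R, (forall t, 0 <= t <= 1 -> continuous h t) ->
  (forall t, 0 <= t <= 1 -> exists k : Z, h t = IZR k) -> ~ h 0 < h 1).
{ clear h; intros h Hc Hz Hlt.
  destruct (Hz 0 ltac:(lra)) as [k0 E0], (Hz 1 ltac:(lra)) as [k1 E1].
  rewrite E0, E1 in Hlt; apply lt_IZR in Hlt.
  assert (Hk : IZR (k0 + 1) <= IZR k1) by (apply IZR_le; lia).
  rewrite plus_IZR in Hk.
  (* If h increased from k0, it would take the value k0 + 1/2; doubling turns this into an equation
     between an even and an odd integer. *)
  destruct (Ranalysis5.IVT_interv (fun t => h t - (IZR k0 + / 2)) 0 1) as [c [Hc1 Hc2]].
  - intros a Ha; apply continuity_pt_minus; [|apply continuity_pt_const; now intros ? ?].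
    now apply continuity_pt_filterlim, Hc.
  - lra.
  - lra.
  - lra.
  - destruct (Hz c Hc1) as [k E].
    assert (Hk2 : IZR (2 * k) = IZR (2 * k0 + 1)).
    { rewrite plus_IZR, !mult_IZR; lra. }
    apply eq_IZR in Hk2; lia. }
intros Hc Hz; destruct (Rtotal_order (h 0) (h 1)) as [H|[H|H]]; [|exact H|].
- now destruct (Hle h).
- destruct (Hle (fun t => - h t)); [| |lra].
  + intros t Ht; apply (continuous_opp (V := R_NormedModule)), Hc, Ht.
  + intros t Ht; destruct (Hz t Ht) as [k E]; exists (- k)%Z; rewrite E, opp_IZR; reflexivity.
Qed.

Lemma continuous_Im (z : C) : continuous (fun w : C => Im w) z.
Proof. destruct z; apply continuous_snd. Qed.

(** The discreteness of the kernel of [Cexp], in the form in which both uses need it: for the defect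
    of the logarithms of J, and for two branches of log psi. *)
Lemma continuous_log_of_1 (f : R -> C) :
  (forall t, 0 <= t <= 1 -> continuous f t) ->
  (forall t, 0 <= t <= 1 -> Cexp (f t) = 1) -> f 0 = f 1.
Proof.
intros Hc H1; pose proof PI_RGT_0.
assert (E : Im (f 0) / (2 * PI) = Im (f 1) / (2 * PI)).
{ apply (continuous_integer_valued (fun t => Im (f t) / (2 * PI))).
  - intros t Ht; apply (continuous_mult (K := R_AbsRing)); [|apply continuous_const].
    apply (continuous_comp f (fun w : C => Im w)); [now apply Hc|apply continuous_Im].
  - intros t Ht; destruct (Cexp_eq_1 _ (H1 t Ht)) as [k Hk].
    exists k; rewrite Hk; simpl; field; lra. }
destruct (Cexp_eq_1 (f 0)) as [k0 E0]; [apply H1; lra|].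
destruct (Cexp_eq_1 (f 1)) as [k1 E1]; [apply H1; lra|].
apply injective_projections.
- rewrite E0, E1; simpl; ring.
- apply Rmult_eq_reg_r with (/ (2 * PI)); [exact E|].
  apply Rinv_neq_0_compat; lra.
Qed.

Definition log_cocycle_defect (g h : mat2) (w : C) : C :=
  (log_disk_automorphy g (disk_mobius h w) + log_disk_automorphy h w
   - log_disk_automorphy (mat2_mul g h) w)%C.

Lemma Cexp_log_cocycle_defect (g h : mat2) (w : C) :
  det2 g = 1 -> det2 h = 1 -> Cmod w <= 1 -> Cexp (log_cocycle_defect g h w) = 1.
Proof.
intros Hg Hh Hw; unfold log_cocycle_defect.
assert (Hgh : det2 (mat2_mul g h) = 1) by (rewrite det2_mul, Hg, Hh; apply Rmult_1_r).
pose proof (disk_automorphy_neq_0 h w Hh Hw).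
pose proof (disk_automorphy_neq_0 _ w Hgh Hw) as H0.
pose proof (Cmod_disk_mobius_le h w Hh Hw).
rewrite Cexp_minus, Cexp_plus, !Cexp_log_disk_automorphy by assumption.
rewrite disk_automorphy_mul in H0 |- * by assumption.
set (x := (disk_automorphy g (disk_mobius h w) * disk_automorphy h w)%C) in *; now field.
Qed.

(** Along the radius from 0 to w the defect is continuous and exponentiates to 1. The radius stays
    in the closed disk even when w is on the circle. *)
Lemma log_cocycle_defect_const (g h : mat2) (w : C) :
  det2 g = 1 -> det2 h = 1 -> Cmod w <= 1 ->
  log_cocycle_defect g h w = log_cocycle_defect g h 0.
Proof.
intros Hg Hh Hw.
assert (Hgh : det2 (mat2_mul g h) = 1) by (rewrite det2_mul, Hg, Hh; apply Rmult_1_r).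
replace w with (0 + RtoC 1 * (w - 0))%C at 1 by ring.
replace (RtoC 0) with (0 + RtoC 0 * (w - 0))%C at 3 by ring.
symmetry.
assert (Hs : forall t, 0 <= t <= 1 -> Cmod (0 + RtoC t * (w - 0)) <= 1).
{ intros t Ht; replace (0 + t * (w - 0))%C with (RtoC t * w)%C by ring.
  rewrite Cmod_mult, Cmod_R, Rabs_pos_eq by lra; pose proof (Cmod_ge_0 w); nra. }
apply (continuous_log_of_1 (fun t => log_cocycle_defect g h (0 + RtoC t * (w - 0)))).
- intros t Ht; specialize (Hs t Ht).
  apply (continuous_comp (fun t : R => 0 + RtoC t * (w - 0))%C (log_cocycle_defect g h)).
  + apply continuous_segment.
  + apply continuous_C_minus; [apply continuous_C_plus|].
    * apply (continuous_comp (disk_mobius h) (log_disk_automorphy g)).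
      -- now apply continuous_disk_mobius.
      -- apply continuous_log_disk_automorphy; [exact Hg|now apply Cmod_disk_mobius_le].
    * now apply continuous_log_disk_automorphy.
    * now apply continuous_log_disk_automorphy.
- intros t Ht; apply Cexp_log_cocycle_defect; auto.
Qed.

(* The Cayley transform of [tan (PI t)]. *)
Definition circle_pt (t : R) : C := (- Cexp (2 * PI * t * Ci))%C.

Lemma circle_pt_eq (t : R) : circle_pt t = (- cos (2 * PI * t), - sin (2 * PI * t)).
Proof.
unfold circle_pt, Cexp; simpl.
match goal with |- context [exp ?e] => replace e with 0 by ring end.
match goal with |- context [cos ?e] => replace e with (2 * PI * t) by ring end.
rewrite exp_0; apply injective_projections; simpl; ring.
Qed.

Lemma Cmod_circle_pt (t : R) : Cmod (circle_pt t) = 1.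
Proof.
unfold circle_pt; rewrite Cmod_opp, Cmod_Cexp; simpl.
match goal with |- exp ?e = _ => replace e with 0 by ring end; apply exp_0.
Qed.

Lemma continuous_circle_pt (t : R) : continuous circle_pt t.
Proof.
apply (continuous_opp (V := C_R_NormedModule)).
apply (continuous_comp (fun t : R => 2 * PI * t * Ci)%C Cexp).
- apply continuous_C_mult; [|apply continuous_const].
  apply continuous_C_mult; [apply continuous_const|].
  apply continuous_RtoC.
- eapply is_derive_C_continuous, is_derive_Cexp.
Qed.

Definition circle_lift (g : mat2) (t : R) : R :=
  t - Im (log_disk_automorphy g (circle_pt t)) / PI.

(** The rotation conj(J) / J equals exp (-2 i Im log J), and [circle_pt] turns by 2 PI per unit of
    t; the quotient is the shift by Im log J / PI. *)
Lemma circle_pt_lift (g : mat2) (t : R) : det2 g = 1 ->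
  circle_pt (circle_lift g t) = disk_mobius g (circle_pt t).
Proof.
intros Hg; set (w := circle_pt t).
assert (Hw : Cmod w = 1) by apply Cmod_circle_pt.
pose proof (disk_automorphy_neq_0 g w Hg (Req_le _ _ Hw)) as H0.
assert (Hww : (w * Cconj w = 1)%C).
{ rewrite <- Cmod2_conj, Hw; f_equal; ring. }
unfold disk_mobius.
replace (Cconj (disk_p g) * w + Cconj (disk_r g))%C with (w * Cconj (disk_automorphy g w))%C.
2: { unfold disk_automorphy; rewrite Cplus_conj, Cmult_conj.
  transitivity (Cconj (disk_p g) * w + Cconj (disk_r g) * (w * Cconj w))%C; [ring|].
  rewrite Hww; ring. }
unfold circle_lift; fold w.
rewrite <- Cexp_log_disk_automorphy by (auto; lra).
set (l := log_disk_automorphy g w).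
replace (Cconj (Cexp l)) with (Cexp (Cconj l)).
2: { unfold Cexp; destruct l; simpl; rewrite cos_neg, sin_neg.
  apply injective_projections; simpl; ring. }
unfold Cdiv; rewrite <- Cexp_opp, <- Cmult_assoc, <- Cexp_plus.
unfold w, circle_pt.
transitivity (- (Cexp (2 * PI * t * Ci) * Cexp (Cconj l + - l)))%C; [|ring].
f_equal; rewrite <- Cexp_plus; f_equal.
pose proof PI_RGT_0; destruct l; apply injective_projections; simpl; field; lra.
Qed.

(** By definition the discrepancy is the defect at [circle_pt t]; its constancy makes it a
    translation, the same as at the interior point 0. *)
Lemma circle_lift_comp (g h : mat2) (t : R) : det2 g = 1 -> det2 h = 1 ->
  circle_lift g (circle_lift h t) =
  circle_lift (mat2_mul g h) t + - (Im (log_cocycle_defect g h 0) / PI).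
Proof.
intros Hg Hh.
rewrite <- (log_cocycle_defect_const g h (circle_pt t)); auto.
2: { rewrite Cmod_circle_pt; lra. }
unfold circle_lift at 1; rewrite circle_pt_lift by exact Hh.
unfold circle_lift, log_cocycle_defect; simpl.
pose proof PI_RGT_0; field; lra.
Qed.

Lemma is_lift_circle_lift (g : SL2) : is_lift g (circle_lift g).
Proof.
pose proof (proj2_sig g) as Hg; change (det2 g = 1) in Hg.
pose proof PI_RGT_0.
split; intros t.
- apply (continuous_minus (V := R_NormedModule)); [apply continuous_id|].
  apply (continuous_mult (K := R_AbsRing)); [|apply continuous_const].
  apply (continuous_comp (fun t => log_disk_automorphy g (circle_pt t)) (fun w : C => Im w)).
  + apply (continuous_comp circle_pt (log_disk_automorphy g)).
    * apply continuous_circle_pt.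
    * apply continuous_log_disk_automorphy; [exact Hg|rewrite Cmod_circle_pt; lra].
  + apply continuous_Im.
- assert (HJ : Cexp (log_disk_automorphy g (circle_pt t)) = disk_automorphy g (circle_pt t)).
  { apply Cexp_log_disk_automorphy; [exact Hg|rewrite Cmod_circle_pt; lra]. }
  unfold circle_lift; set (l := log_disk_automorphy g (circle_pt t)) in *; clearbody l.
  rewrite circle_pt_eq in HJ.
  replace (2 * PI * t) with (2 * (PI * t)) in HJ by ring.
  rewrite cos_2a, sin_2a in HJ.
  (* |J| is the length of the image under g of the unit vector (sin (PI t), cos (PI t)), so this
     scalar normalizes that image. *)
  exists (exp (- Re l)); split; [apply Rgt_not_eq, exp_pos|].
  unfold P1_cover; replace (PI * (t - Im l / PI)) with (PI * t - Im l) by (field; lra).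
  rewrite sin_minus, cos_minus, exp_Ropp; unfold mat2_vec, fst, snd.
  set (s := sin (PI * t)) in *; set (c := cos (PI * t)) in *.
  assert (Hsc : s * s + c * c = 1).
  { pose proof (sin2_cos2 (PI * t)) as E; unfold Rsqr in E; exact E. }
  clearbody s c.
  (* [HR] and [HI] are the two parts of J = (X - i Y) (c + i s). Hence the angle of X + i Y is PI t
     - Im l, the one reached by the lift. *)
  set (Y := m11 g * s + m12 g * c); set (X := m21 g * s + m22 g * c).
  assert (HR : exp (Re l) * cos (Im l) = X * c + Y * s).
  { apply (f_equal Re) in HJ; unfold Cexp in HJ; simpl Re in HJ at 1; rewrite HJ.
    apply Rminus_diag_uniq; unfold X, Y; simpl.
    match goal with |- ?e = 0 =>
      replace e with ((m11 g + m22 g) / 2 * (1 - (s * s + c * c))) by field end.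
    rewrite Hsc; ring. }
  assert (HI : exp (Re l) * sin (Im l) = X * s - Y * c).
  { apply (f_equal Im) in HJ; unfold Cexp in HJ; simpl Im in HJ at 1; rewrite HJ.
    apply Rminus_diag_uniq; unfold X, Y; simpl.
    match goal with |- ?e = 0 =>
      replace e with ((m21 g - m12 g) / 2 * (1 - (s * s + c * c))) by field end.
    rewrite Hsc; ring. }
  pose proof (exp_pos (Re l)) as He; set (e := exp (Re l)) in *.
  split; apply Rmult_eq_reg_l with e; try lra; rewrite <- Rmult_assoc, Rinv_r, Rmult_1_l by lra.
  + transitivity (s * (e * cos (Im l)) - c * (e * sin (Im l))); [ring|].
    rewrite HR, HI; transitivity (Y * (s * s + c * c)); [ring|rewrite Hsc; ring].
  + transitivity (c * (e * cos (Im l)) + s * (e * sin (Im l))); [ring|].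
    rewrite HR, HI; transitivity (X * (s * s + c * c)); [ring|rewrite Hsc; ring].
Qed.

(** * The cocycle Re tau *)

(* A logarithm of [Delta z * (z + Ci)^12], since [1 - Ci z = - Ci (z + Ci)] and
   [(- Ci)^12 = 1]. *)
Definition log_weight (z : C) : C := (log_Delta z + 12 * Clog (1 - Ci * z))%C.

Definition log_psi (g : mat2) (z : C) : C :=
  (log_weight (mobius g z) - log_weight z - 12 * log_disk_automorphy g (cayley z))%C.

Lemma Re_one_minus_Ci_pos (z : C) : upper_half_plane z -> 0 < Re (1 - Ci * z).
Proof. unfold upper_half_plane; destruct z; simpl; lra. Qed.

Lemma Cexp_log_weight (z : C) : upper_half_plane z ->
  Cexp (log_weight z) = (Defs.Delta z * (z + Ci) ^ 12)%C.
Proof.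
intros Hz; unfold log_weight.
rewrite Cexp_plus, Cexp_log_Delta by exact Hz; f_equal.
replace (RtoC 12) with (RtoC (INR 12)) by (f_equal; simpl; ring).
rewrite Cexp_mult_INR, Cexp_Clog by now apply Re_one_minus_Ci_pos.
replace (1 - Ci * z)%C with (- Ci * (z + Ci))%C
  by (destruct z; apply injective_projections; simpl; ring).
rewrite Cpow_mult_l.
replace ((- Ci) ^ 12)%C with (RtoC 1); [ring|].
transitivity ((Ci * Ci) ^ 6)%C; [|ring].
replace (Ci * Ci)%C with (- (1))%C by (apply injective_projections; simpl; ring); ring.
Qed.

Lemma Delta_neq_0 (z : C) : upper_half_plane z -> Defs.Delta z <> 0.
Proof. intros Hz; rewrite <- Cexp_log_Delta by exact Hz; apply Cexp_neq_0. Qed.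

Lemma Cexp_log_psi (g : mat2) (z : C) : det2 g = 1 -> upper_half_plane z ->
  Cexp (log_psi g z) = psi g z.
Proof.
intros Hg Hz; pose proof (mobius_uhp g z Hg Hz) as Hgz.
pose proof (Cmod_cayley_le z Hz) as Hc.
unfold log_psi; rewrite !Cexp_minus, !Cexp_log_weight by assumption.
replace (RtoC 12) with (RtoC (INR 12)) by (f_equal; simpl; ring).
rewrite Cexp_mult_INR, Cexp_log_disk_automorphy by assumption.
pose proof (cayley_automorphy g z Hg Hz) as E.
pose proof (automorphy_neq_0 g z Hg Hz) as H1.
pose proof (plus_Ci_neq_0 z Hz) as H2.
pose proof (disk_automorphy_neq_0 g _ Hg Hc) as H3.
pose proof (Delta_neq_0 z Hz) as H4.
unfold psi, Delta_slash; rewrite Hg.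
set (d := disk_automorphy g (cayley z)) in *; clearbody d.
set (j := automorphy g z) in *; clearbody j.
set (D := Defs.Delta z) in *; clearbody D.
set (D' := Defs.Delta (mobius g z)); clearbody D'.
(* The twelfth powers of z + i and of d now cancel, leaving the j^(-12) of the slash operator. *)
replace (mobius g z + Ci)%C with ((z + Ci) * d / j)%C by (rewrite <- E; now field).
set (u := (z + Ci)%C) in *; clearbody u.
field; tauto.
Qed.

Lemma C1_uhp_log_weight : exists f', C1_uhp log_weight f'.
Proof.
destruct C1_uhp_log_Delta as [f' Hf'].
eexists; apply C1_uhp_plus; [exact Hf'|].
apply C1_uhp_scal, C1_uhp_Clog; [|exact Re_one_minus_Ci_pos].
apply C1_uhp_minus; [apply C1_uhp_const|apply C1_uhp_scal, C1_uhp_id].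
Qed.

Lemma C1_uhp_mobius (g : mat2) : det2 g = 1 -> exists f', C1_uhp (mobius g) f'.
Proof.
intros Hg; eexists; apply C1_uhp_div.
- apply C1_uhp_plus; [apply C1_uhp_scal, C1_uhp_id|apply C1_uhp_const].
- apply C1_uhp_plus; [apply C1_uhp_scal, C1_uhp_id|apply C1_uhp_const].
- intros z; now apply automorphy_neq_0.
Qed.

Lemma C1_uhp_cayley : exists f', C1_uhp cayley f'.
Proof.
eexists; apply C1_uhp_div.
- apply C1_uhp_minus; [apply C1_uhp_id|apply C1_uhp_const].
- apply C1_uhp_plus; [apply C1_uhp_id|apply C1_uhp_const].
- exact plus_Ci_neq_0.
Qed.

Lemma C1_uhp_log_psi (g : mat2) : det2 g = 1 -> exists f', C1_uhp (log_psi g) f'.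
Proof.
intros Hg.
destruct C1_uhp_log_weight as [Q' HQ], (C1_uhp_mobius g Hg) as [m' Hm],
  C1_uhp_cayley as [c' Hc].
eexists; apply C1_uhp_minus; [apply C1_uhp_minus|].
- apply (C1_uhp_comp _ _ _ _ HQ Hm); intros z; now apply mobius_uhp.
- exact HQ.
- apply C1_uhp_scal, C1_uhp_plus; [apply C1_uhp_const|].
  apply C1_uhp_Clog.
  + apply C1_uhp_plus; [apply C1_uhp_const|apply C1_uhp_scal, Hc].
  + intros z Hz; apply Re_disk_ratio_pos; [exact Hg|now apply Cmod_cayley_le].
Qed.

Lemma C_derive_psi (g : mat2) (z l : C) : det2 g = 1 -> upper_half_plane z ->
  is_derive (log_psi g) z l -> C_derive (psi g) z = (l * psi g z)%C.
Proof.
intros Hg Hz Hl; apply is_C_derive_unique.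
assert (D : is_derive (fun y => Cexp (log_psi g y)) z (l * psi g z)%C).
{ rewrite <- Cexp_log_psi, Cmult_comm by assumption.
  apply (is_derive_C_comp Cexp); [apply is_derive_Cexp|exact Hl]. }
refine (is_derive_ext_loc _ _ _ _ _ D).
(* The disk of radius Im z about z stays in H, where psi is the exponential of [log_psi]. *)
exists (mkposreal _ Hz); intros y Hy.
apply Cexp_log_psi; [exact Hg|].
pose proof (im_le_Cmod (y - z)) as H.
assert (Hy' : Cmod (y - z) < Im z) by exact Hy.
apply Rabs_le_between in H; unfold upper_half_plane; destruct y, z; simpl in *; lra.
Qed.

Lemma segment_int_ext (f g : C -> C) (a b : C) :
  upper_half_plane a -> upper_half_plane b ->
  (forall z, upper_half_plane z -> f z = g z) ->
  segment_int f a b = segment_int g a b.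
Proof.
intros Ha Hb H; unfold segment_int.
apply (RInt_ext (V := C_R_CompleteNormedModule)).
intros t Ht; rewrite Rmin_left, Rmax_right in Ht by lra.
f_equal; apply H, (Im_segment_gt 0); [exact Ha|exact Hb|lra].
Qed.

(** On H the logarithmic derivative in [mu] is the derivative of [log_psi], so the integral is a
    difference of values of a primitive. *)
Lemma tau_log_psi (z0 : C) (g1 g2 : SL2) : upper_half_plane z0 ->
  tau z0 g1 g2 =
    (/ (12 * RtoC PI * Ci) * (log_psi g1 (mobius g2 z0) - log_psi g1 z0))%C.
Proof.
intros Hz.
pose proof (proj2_sig g1) as Hg1; change (det2 g1 = 1) in Hg1.
pose proof (proj2_sig g2) as Hg2; change (det2 g2 = 1) in Hg2.
destruct (C1_uhp_log_psi g1 Hg1) as [f' Hf].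
pose proof (mobius_uhp g2 z0 Hg2 Hz) as Hgz.
set (c := (/ (12 * RtoC PI * Ci))%C).
unfold tau; rewrite (segment_int_ext _ (fun z => c * f' z)%C _ _ Hz Hgz).
- rewrite (segment_int_C1 _ _ _ _ (C1_uhp_scal c _ _ Hf) Hz Hgz); ring.
- intros z Hz'; unfold mu; fold c; f_equal.
  rewrite (C_derive_psi g1 z (f' z)) by (auto; now apply Hf).
  rewrite <- Cexp_log_psi by assumption; field; apply Cexp_neq_0.
Qed.

(** Along the segment from a to b, L - M is a continuous logarithm of 1, hence has equal values at
    the ends. *)
Lemma log_branch_difference (f L M : C -> C) (a b : C) :
  upper_half_plane a -> upper_half_plane b ->
  is_log_branch f L -> is_log_branch f M -> (L b - L a = M b - M a)%C.
Proof.
intros Ha Hb HL HM.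
assert (E : (L a - M a = L b - M b)%C).
{ replace a with (a + RtoC 0 * (b - a))%C by ring.
  replace b with (a + RtoC 1 * (b - a))%C at 3 4 by ring.
  apply (continuous_log_of_1 (fun t => let z := a + RtoC t * (b - a) in L z - M z)%C).
  - intros t Ht; pose proof (Im_segment_gt 0 a b t Ha Hb Ht) as Hu.
    apply (continuous_comp (fun t : R => a + RtoC t * (b - a))%C (fun z => L z - M z)%C).
    + apply continuous_segment.
    + apply continuous_C_minus; [now apply HL|now apply HM].
  - intros t Ht; pose proof (Im_segment_gt 0 a b t Ha Hb Ht) as Hu.
    cbv zeta; rewrite Cexp_minus, (proj2 (HL _ Hu)), (proj2 (HM _ Hu)).
    field; rewrite <- (proj2 (HL _ Hu)); apply Cexp_neq_0. }
replace (L b)%C with (L b - M b + M b)%C by ring; rewrite <- E; ring.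
Qed.

Lemma is_log_branch_log_psi (g : mat2) : det2 g = 1 -> is_log_branch (psi g) (log_psi g).
Proof.
intros Hg z Hz; split; [|now apply Cexp_log_psi].
destruct (C1_uhp_log_psi g Hg) as [f' Hf]; now apply (C1_uhp_continuous _ f').
Qed.

Lemma Re_tau (z0 : C) (g1 g2 : SL2) : upper_half_plane z0 ->
  Re (tau z0 g1 g2) = / (12 * PI) * Im (log_psi g1 (mobius g2 z0) - log_psi g1 z0).
Proof.
intros Hz; rewrite tau_log_psi by exact Hz; pose proof PI_RGT_0.
replace (/ (12 * RtoC PI * Ci))%C with (- (RtoC (/ (12 * PI)) * Ci))%C.
- simpl; ring.
- apply injective_projections; simpl; field; lra.
Qed.

(** The first term completes log J(g1, g2 w0) - log J(g1, w0) to the full defect; the second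
    collects the values of Q, whose contribution to [Re tau] is already a coboundary. *)
Definition euler_primitive (z0 : C) (g : mat2) : R :=
  / PI * Im (log_disk_automorphy g (cayley z0)) -
  / (12 * PI) * Im (log_weight (mobius g z0) - log_weight z0).

Lemma Re_tau_eq (z0 : C) (g1 g2 : SL2) : upper_half_plane z0 ->
  Re (tau z0 g1 g2) =
  - (Im (log_cocycle_defect g1 g2 0) / PI) +
  coboundary1 mat2_mul (euler_primitive z0) g1 g2.
Proof.
intros Hz.
pose proof (proj2_sig g1) as Hg1; change (det2 g1 = 1) in Hg1.
pose proof (proj2_sig g2) as Hg2; change (det2 g2 = 1) in Hg2.
pose proof (Cmod_cayley_le z0 Hz) as Hc.
rewrite Re_tau, <- (log_cocycle_defect_const g1 g2 (cayley z0)) by assumption.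
unfold log_psi, coboundary1, euler_primitive, log_cocycle_defect.
rewrite cayley_mobius, mobius_mul by assumption.
(* Once the arguments agree by the group law, the values of the logarithms may be arbitrary: the
   identity is linear in their imaginary parts. *)
repeat match goal with
| |- context [log_weight ?z] => generalize (log_weight z); intro
| |- context [log_disk_automorphy ?g ?w] => generalize (log_disk_automorphy g w); intro
end.
pose proof PI_RGT_0; unfold Im; simpl; field; lra.
Qed.

Lemma mat2_mul_assoc (g h k : mat2) :
  mat2_mul (mat2_mul g h) k = mat2_mul g (mat2_mul h k).
Proof. unfold mat2_mul; simpl; f_equal; ring. Qed.

(** Taking the defect of g and h at the image of 0 under k, which constancy allows, makes all
    logarithms cancel in pairs. *)
Lemma log_cocycle_defect_cocycle (g h k : mat2) :
  det2 g = 1 -> det2 h = 1 -> det2 k = 1 ->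
  (log_cocycle_defect h k 0 - log_cocycle_defect (mat2_mul g h) k 0 +
   log_cocycle_defect g (mat2_mul h k) 0 - log_cocycle_defect g h 0 = 0)%C.
Proof.
intros Hg Hh Hk.
assert (H0 : Cmod 0 <= 1) by (rewrite Cmod_0; lra).
rewrite <- (log_cocycle_defect_const g h (disk_mobius k 0))
  by (auto; now apply Cmod_disk_mobius_le).
unfold log_cocycle_defect.
rewrite mat2_mul_assoc, disk_mobius_mul by assumption; ring.
Qed.

Lemma log_cocycle_defect_integer (g h : mat2) : det2 g = 1 -> det2 h = 1 ->
  exists n : Z, - (Im (log_cocycle_defect g h 0) / PI) = IZR n.
Proof.
intros Hg Hh.
destruct (Cexp_eq_1 (log_cocycle_defect g h 0)) as [k Hk].
- apply Cexp_log_cocycle_defect; auto; rewrite Cmod_0; lra.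
(* The values are even: logarithms of J differ by multiples of 2 PI i, whereas a translation by 1
   amounts to a change by PI i, that is, to passing from g to -g. *)
- exists (-2 * k)%Z; rewrite Hk, mult_IZR; simpl.
  pose proof PI_RGT_0; field; lra.
Qed.

Theorem theorem16 (z0 : C) (hz0 : upper_half_plane z0) :
  (forall (g1 g2 : SL2) (L : C -> C),
     is_log_branch (psi g1) L ->
     tau z0 g1 g2 =
       (/ (12 * RtoC PI * Ci) * (L (mobius g2 z0) - L z0))%C) /\
  euler_class (fun g1 g2 : SL2 => Re (tau z0 g1 g2)).
Proof.
assert (Hdet : forall g : SL2, det2 g = 1) by (intros g; exact (proj2_sig g)).
split; [|split].
- intros g1 g2 L HL; rewrite tau_log_psi by exact hz0; f_equal.
  apply log_branch_difference with (psi g1); auto using is_log_branch_log_psi.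
  now apply mobius_uhp.
- intros g1 g2 g3; unfold coboundary2; rewrite !Re_tau_eq by exact hz0.
  pose proof (log_cocycle_defect_cocycle g1 g2 g3 (Hdet _) (Hdet _) (Hdet _)) as E.
  unfold coboundary1; change (SL2_mat (SL2_mul g1 g2)) with (mat2_mul g1 g2).
  change (SL2_mat (SL2_mul g2 g3)) with (mat2_mul g2 g3); rewrite mat2_mul_assoc.
  revert E; repeat match goal with
  | |- context [log_cocycle_defect ?g ?h ?w] => generalize (log_cocycle_defect g h w); intro
  end.
  intros E; apply (f_equal Im) in E; unfold Im in *; simpl in E.
  (* The values of [euler_primitive] cancel; what remains is -1 / PI times the imaginary part of the
     relation [E]. *)
  match goal with |- ?e = 0 => replace e with (- (0 / PI)) end.
  + unfold Rdiv; ring.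
  + rewrite <- E; field; apply PI_neq0.
(* The integers are only known to exist pair by pair; choice assembles them into a cochain. *)
- set (n := fun g1 g2 : SL2 => proj1_sig (constructive_indefinite_description _
    (log_cocycle_defect_integer g1 g2 (Hdet g1) (Hdet g2)))).
  assert (Hn : forall g1 g2 : SL2, - (Im (log_cocycle_defect g1 g2 0) / PI) = IZR (n g1 g2)).
  { intros g1 g2; exact (proj2_sig (constructive_indefinite_description _
      (log_cocycle_defect_integer g1 g2 (Hdet g1) (Hdet g2)))). }
  exists (fun g : SL2 => circle_lift g), n; split; [split|].
  + exact is_lift_circle_lift.
  + intros g1 g2 t; rewrite <- Hn; now apply circle_lift_comp.
  + exists (fun g : SL2 => euler_primitive z0 g); intros g1 g2.
    rewrite Re_tau_eq, Hn by exact hz0; unfold coboundary1; simpl; ring.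
Qed.
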